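(* Let $g>1$. Every finite subgroup of $\mathrm{Aut}\,\pi_1\mathcal F_g$ is either cyclic or dihedral.
   Context: $\mathcal F_g$ denotes the closed orientable surface of genus $g$ and $\pi_1\mathcal F_g$ its fundamental group; $\mathrm{Aut}$ denotes the automorphism group. *)

(* Defs.v *)
From Stdlib Require Import ClassicalEpsilon Relations.Relation_Operators.
From mathcomp Require Import all_boot.
Set Implicit Arguments. Unset Strict Implicit. Unset Printing Implicit Defensive.

(* Letters: ((i, k), e) is the generator a_i (k = false) or b_i (k = true),
   raised to the power -1 if e = true and +1 if e = false. *)
Definition letter (g : nat) : Type := ('I_g * bool * bool)%type.
Definition word (g : nat) : Type := seq (letter g).

Definition linv g (x : letter g) : letter g := (x.1, ~~ x.2).
Definition winv g (w : word g) : word g := rev (map (@linv g) w).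

Definition comm_word g (i : 'I_g) : word g :=
  [:: (i, false, false); (i, true, false); (i, false, true); (i, true, true)].

Definition relator g : word g := flatten (map (@comm_word g) (enum 'I_g)).

Inductive surf_step g : word g -> word g -> Prop :=
| step_free (u v : word g) (x : letter g) :
    surf_step (u ++ x :: linv x :: v) (u ++ v)
| step_rel (u v : word g) : surf_step (u ++ relator g ++ v) (u ++ v).

(* Word equality in  < a_1,b_1,...,a_g,b_g | prod [a_i,b_i] > . *)
Arguments surf_step : clear implicits.
Definition surf_rel g : word g -> word g -> Prop :=
  clos_refl_sym_trans (word g) (surf_step g).

Definition pi1 (g : nat) : Type :=
  {P : word g -> Prop | exists w, P = @surf_rel g w}.

Definition cls g (w : word g) : pi1 g :=
  exist _ (@surf_rel g w) (ex_intro _ w erefl).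

Definition rep g (x : pi1 g) : word g :=
  proj1_sig (constructive_indefinite_description _ (proj2_sig x)).

Definition pmul g (x y : pi1 g) : pi1 g := cls (rep x ++ rep y).
Definition pone g : pi1 g := cls [::].
Definition pinv g (x : pi1 g) : pi1 g := cls (winv (rep x)).

Definition is_aut g (f : pi1 g -> pi1 g) : Prop :=
  bijective f /\ forall x y, f (pmul x y) = pmul (f x) (f y).

Definition fpow g (f : pi1 g -> pi1 g) (n : nat) : pi1 g -> pi1 g :=
  iter n (fun h => f \o h) id.

Definition aut_subgroup g (S : (pi1 g -> pi1 g) -> Prop) : Prop :=
  (forall f, S f -> is_aut f) /\
  S id /\
  (forall f h, S f -> S h -> S (f \o h)) /\
  (forall f, S f -> exists2 h, S h & h \o f = id).

Definition finite_set g (S : (pi1 g -> pi1 g) -> Prop) : Prop :=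
  exists l : seq (pi1 g -> pi1 g), forall f, S f -> List.In f l.

Definition cyclic_sg g (S : (pi1 g -> pi1 g) -> Prop) : Prop :=
  exists2 r, S r & forall f, S f -> exists k, f = fpow r k.

Definition dihedral_sg g (S : (pi1 g -> pi1 g) -> Prop) : Prop :=
  exists n r s, [/\ 2 <= n, S r, S s,
    fpow r n = id & forall k, 0 < k < n -> fpow r k <> id] /\
    [/\ s \o s = id, s \o r \o s = fpow r n.-1,
        (forall k, s <> fpow r k) &
        (forall f, S f <-> exists k, f = fpow r k \/ f = fpow r k \o s)].

(* Main.v *)
Require Import Defs.
From Stdlib Require Import Relations.Relation_Operators ProofIrrelevance.
From Stdlib Require Import ClassicalEpsilon.
From HB Require Import structures.
From mathcomp Require Import all_boot ssralg ssrnum ssrint zify.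
From mathcomp Require Import boolp.

(**
Work with cochains modulo 2 on the Cayley complex of the surface group [pi]. The
dual complex is again a Cayley complex of [pi] (the chain [dual_path] makes the
duality explicit), and this gives the two facts that carry the proof: a finite
1-cocycle is the coboundary of a finite set, and a finite 2-cochain is the
coboundary of a finite 1-cochain exactly when it is even.

An element [x] of infinite order determines an end, the ray of its positive
powers; two elements determine the same end when they have a common positive
power. Summing over the translates by powers of [x] shows that cochains
supported near one ray have no cohomology in degrees 1 and 2. Hence two distinct
ends [x], [y] determine a set of elements of [pi] with coboundary near the two
rays, unique up to complement and up to sets near the two rays: it plays the
part of a half-plane. Two further ends are separated by [x], [y] when they lie
on opposite sides, and separation has the properties of the separation of pairs
of points on a circle. It is defined from the group alone, so that it is
invariant under automorphisms.

A finite group of automorphisms thus acts on a finite set of ends and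
preserves its cyclic order up to reversal. It commutes with the two moves "go to the next flag" and "turn the flag
around" on pairs of neighbouring ends, and a group acting freely on flags and
commuting with these moves is cyclic or dihedral. The action on flags is free
because an automorphism of finite order that fixes enough ends multiplies each
generator by an element [t] which commutes with powers of [b_0] and [a_1] and
has exponent 0 in [a_0]; writing [pi] as the semidirect product of a free group
by the powers of [a_0], one finds [t = 1].
*)

Set Implicit Arguments. Unset Strict Implicit. Unset Printing Implicit Defensive.
Local Open Scope group_scope.

(** * Words and the group structure *)

Section SurfaceWords.
Variable g : nat.
Implicit Types (u v w : word g).

Lemma linvK : involutive (@linv g).
Proof. by case=> x e; rewrite /linv /= negbK. Qed.

Lemma winvK : involutive (@winv g).
Proof.
move=> w; rewrite /winv map_rev revK -map_comp -[RHS]map_id.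
by apply: eq_map => x /=; rewrite linvK.
Qed.

Lemma surf_rel_refl w : surf_rel w w.
Proof. exact: rst_refl. Qed.

Lemma surf_rel_sym u v : surf_rel u v -> surf_rel v u.
Proof. exact: rst_sym. Qed.

Lemma surf_rel_trans u v w : surf_rel u v -> surf_rel v w -> surf_rel u w.
Proof. exact: rst_trans. Qed.

Lemma surf_rel_ctx x y u v :
  surf_rel u v -> surf_rel (x ++ u ++ y) (x ++ v ++ y).
Proof.
elim=> {u v} [u v | u | u v _ IH | u v w _ IH1 _ IH2].
- case=> [a b l | a b]; apply: rst_step.
    have -> : x ++ (a ++ l :: linv l :: b) ++ y
            = (x ++ a) ++ l :: linv l :: (b ++ y) by rewrite -!catA.
    have -> : x ++ (a ++ b) ++ y = (x ++ a) ++ (b ++ y) by rewrite -!catA.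
    exact: step_free.
  have -> : x ++ (a ++ relator g ++ b) ++ y
          = (x ++ a) ++ relator g ++ (b ++ y) by rewrite -!catA.
  have -> : x ++ (a ++ b) ++ y = (x ++ a) ++ (b ++ y) by rewrite -!catA.
  exact: step_rel.
- exact: rst_refl.
- exact: rst_sym.
- exact: rst_trans IH1 IH2.
Qed.

Lemma surf_rel_cat u u' v v' :
  surf_rel u u' -> surf_rel v v' -> surf_rel (u ++ v) (u' ++ v').
Proof.
move=> hu hv; apply: (@surf_rel_trans _ (u' ++ v)).
  exact: (@surf_rel_ctx [::] v _ _ hu).
by have := @surf_rel_ctx u' [::] _ _ hv; rewrite !cats0.
Qed.

Lemma surf_rel_winvr w : surf_rel (w ++ winv w) [::].
Proof.
elim: w => [|l w IH]; first exact: surf_rel_refl.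
rewrite /winv map_cons rev_cons -/(winv w) -cats1 /= catA.
have h1 := @surf_rel_ctx [:: l] [:: linv l] _ _ IH.
apply: (surf_rel_trans h1) => /=.
exact: rst_step (@step_free g [::] [::] l).
Qed.

Lemma surf_rel_winvl w : surf_rel (winv w ++ w) [::].
Proof. by rewrite -{2}[w]winvK; apply: surf_rel_winvr. Qed.

Lemma cls_eqP u v : cls u = cls v <-> surf_rel u v.
Proof.
split=> [[e] | h].
  by have := surf_rel_refl v; rewrite -e.
have e : @surf_rel g u = @surf_rel g v.
  apply: funext => w; apply: propext.
  by split; apply: surf_rel_trans => //; apply: surf_rel_sym.
by rewrite /cls; apply: eq_sig_hprop => //= *; apply: proof_irrelevance.
Qed.

Lemma repK : cancel (@rep g) (@cls g).
Proof.
move=> x; rewrite /rep.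
case: (ClassicalEpsilon.constructive_indefinite_description _ _) => w e /=.
case: x e => P hP /= e; rewrite /cls.
by apply: eq_sig_hprop => //= *; apply: proof_irrelevance.
Qed.

Lemma rep_cls w : surf_rel (rep (cls w)) w.
Proof. by apply/cls_eqP; rewrite repK. Qed.

Lemma pmul_cls u v : pmul (cls u) (cls v) = cls (u ++ v).
Proof. by apply/cls_eqP/surf_rel_cat; apply: rep_cls. Qed.

Lemma pmulA : associative (@pmul g).
Proof.
move=> x y z; rewrite -[x]repK -[y]repK -[z]repK.
by rewrite !pmul_cls catA.
Qed.

Lemma pmul1g : left_id (pone g) (@pmul g).
Proof. by move=> x; rewrite -[x]repK /pone pmul_cls. Qed.

Lemma pmulg1 : right_id (pone g) (@pmul g).
Proof. by move=> x; rewrite -[x]repK /pone pmul_cls cats0. Qed.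

Lemma pmulVg : left_inverse (pone g) (@pinv g) (@pmul g).
Proof.
move=> x; rewrite -[in X in pmul _ X](repK x) /pinv pmul_cls.
by apply/cls_eqP/surf_rel_winvl.
Qed.

Lemma pmulgV : right_inverse (pone g) (@pinv g) (@pmul g).
Proof.
move=> x; rewrite -[in X in pmul X _](repK x) /pinv pmul_cls.
by apply/cls_eqP/surf_rel_winvr.
Qed.

End SurfaceWords.

HB.instance Definition _ g := gen_eqMixin (pi1 g).
HB.instance Definition _ g := gen_choiceMixin (pi1 g).

HB.instance Definition _ g := isGroup.Build (pi1 g)
  (@pmulA g) (@pmul1g g) (@pmulg1 g) (@pmulVg g) (@pmulgV g).

(** * The Cayley complex *)

Ltac gsimp :=
  rewrite ?(invgM, invgK, invg1, mulgA, mulgK, mulgVK, mul1g, mulg1, mulVg, mulgV).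

Ltac xor_atoms t :=
  lazymatch t with
  | addb ?a ?b => xor_atoms a; xor_atoms b
  | negb ?a => xor_atoms a
  | true => idtac
  | false => idtac
  | _ => first [is_var t | let b := fresh "b" in set b := t; clearbody b]
  end.

(* Decides equations that hold in every vector space over the two-element
   field. *)
Ltac xor :=
  lazymatch goal with |- ?a = ?b => xor_atoms a; xor_atoms b end;
  repeat match goal with
  | |- context [?b] => is_var b;
      lazymatch type of b with bool => destruct b end
  end; reflexivity.

Lemma addb_cancel (x y : bool) : x (+) y = false -> x = y.
Proof. by case: x; case: y. Qed.

Section CayleyComplex.
Variable g : nat.
Notation P := (pi1 g).
Notation gen := ('I_g * bool)%type.
Notation edge := (P * gen)%type.
Implicit Types (u v w : word g) (x y z : P) (f : edge -> bool) (A : P -> bool).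

Lemma cls_cat u v : cls (u ++ v) = cls u * cls v.
Proof. by rewrite -pmul_cls. Qed.

Lemma cls_nil : cls [::] = 1 :> P.
Proof. by []. Qed.

Lemma cls_relator : cls (relator g) = 1.
Proof.
apply/cls_eqP; rewrite -[relator g]cats0.
exact: rst_step (@step_rel g [::] [::]).
Qed.

Definition gen_elt (s : gen) : P := cls [:: (s, false)].

Lemma cls_linv (l : letter g) : cls [:: linv l] = (cls [:: l])^-1.
Proof.
apply/eqP; rewrite -mulg_eq1 -cls_cat; apply/eqP/cls_eqP => /=.
rewrite -[X in [:: _; X]]linvK.
exact: rst_step (@step_free g [::] [::] (linv l)).
Qed.

Lemma cls_letter (l : letter g) :
  cls [:: l] = if l.2 then (gen_elt l.1)^-1 else gen_elt l.1.
Proof. by case: l => s [] //=; rewrite -cls_linv. Qed.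

Lemma cls_cons l w : cls (l :: w) = cls [:: l] * cls w.
Proof. by rewrite -cls_cat. Qed.

(** An edge is stored with its initial vertex and a positive generator, so an inverse letter leaving
    [y] runs along the edge that starts at [y * (gen_elt l.1)^-1]. *)
Definition ledge y (l : letter g) : edge :=
  if l.2 then (y * (gen_elt l.1)^-1, l.1) else (y, l.1).

Fixpoint path_sum f y w : bool :=
  if w is l :: w' then f (ledge y l) (+) path_sum f (y * cls [:: l]) w' else false.

Definition d0 A : edge -> bool := fun e => A e.1 (+) A (e.1 * gen_elt e.2).
(** Faces are indexed by group elements: the face [y] is glued along the loop at [y] that spells the
    relator. *)
Definition d1 f : P -> bool := fun y => path_sum f y (relator g).

Lemma path_sum_cat f y u v :
  path_sum f y (u ++ v) = path_sum f y u (+) path_sum f (y * cls u) v.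
Proof.
elim: u y => [|l u IH] y /=; first by rewrite cls_nil mulg1.
by rewrite IH addbA [cls (l :: u)]cls_cons mulgA.
Qed.

Lemma path_sum_linv f y l w : path_sum f y (l :: linv l :: w) = path_sum f y w.
Proof.
have e : ledge (y * cls [:: l]) (linv l) = ledge y l.
  by case: l => s [] /=; rewrite /ledge /= cls_letter /=; gsimp.
by rewrite /= e addbA addbb /= cls_linv mulgK.
Qed.

Lemma eq_path_sum f1 f2 y w : f1 =1 f2 -> path_sum f1 y w = path_sum f2 y w.
Proof. by move=> h; elim: w y => //= l w IH y; rewrite h IH. Qed.

Lemma path_sumD f1 f2 y w :
  path_sum (fun e => f1 e (+) f2 e) y w = path_sum f1 y w (+) path_sum f2 y w.
Proof. by elim: w y => //= l w IH y; rewrite IH addbACA. Qed.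

Lemma path_sum0 y w : path_sum (fun=> false) y w = false.
Proof. by elim: w y => //= l w IH y; rewrite IH. Qed.

Lemma path_sum_d0 A y w : path_sum (d0 A) y w = A y (+) A (y * cls w).
Proof.
elim: w y => [|l w IH] y /=; first by rewrite cls_nil mulg1 addbb.
rewrite IH (cls_cons l w) mulgA addbA; congr (_ (+) _).
case: l => s [] /=; rewrite /ledge /d0 cls_letter /= ?mulgVK.
  by rewrite -addbA addbCA addbb addbF.
by rewrite -addbA addbb addbF.
Qed.

Lemma path_sum_exchange (F : edge -> edge -> bool) y w z v :
  path_sum (fun e => path_sum (fun e' => F e' e) y w) z v
  = path_sum (fun e' => path_sum (F e') z v) y w.
Proof.
elim: w y => [|l w IH] y /=; first by rewrite path_sum0.
by rewrite path_sumD IH.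
Qed.

Lemma path_sum_translate f x y w :
  path_sum (fun e => f (x * e.1, e.2)) y w = path_sum f (x * y) w.
Proof.
elim: w y => //= l w IH y; rewrite IH mulgA; congr (_ (+) _).
by case: l => s [] /=; rewrite /ledge /= ?mulgA.
Qed.

(** A free reduction drops an edge crossed back and forth, and deleting a relator drops the boundary
    of one face, where a cocycle sums to zero. *)
Lemma path_sum_cocycle f u v y :
  (forall z, d1 f z = false) -> surf_rel u v -> path_sum f y u = path_sum f y v.
Proof.
move=> cf; elim=> {u v} [u v|//|u v _ -> //|u v w _ -> _ -> //].
case=> [a b l | a b]; rewrite !path_sum_cat ?path_sum_linv //.
by rewrite -/(d1 f _) cf /= cls_relator mulg1.
Qed.

(** Simple connectivity of the Cayley complex: integration along paths from 1 is independent of the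
    path. *)
Lemma cocycle_coboundary f :
  (forall z, d1 f z = false) -> exists A, forall e, f e = d0 A e.
Proof.
move=> cf; exists (fun y => path_sum f 1 (rep y)) => -[y s].
rewrite /d0 /=.
have h : surf_rel (rep (y * gen_elt s)) (rep y ++ [:: (s, false)]).
  by apply/cls_eqP; rewrite cls_cat !repK.
rewrite (path_sum_cocycle _ cf h) path_sum_cat addbA addbb /=.
by rewrite repK mul1g addbF.
Qed.

Lemma d1_d0 A y : d1 (d0 A) y = false.
Proof. by rewrite /d1 path_sum_d0 cls_relator mulg1 addbb. Qed.

Definition gen_a i : P := gen_elt (i, false).
Definition gen_b i : P := gen_elt (i, true).
Definition comm_elt i : P := gen_a i * gen_b i * (gen_a i)^-1 * (gen_b i)^-1.

Definition prefix_word n : word g :=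
  flatten (map (@comm_word g) (take n (enum 'I_g))).
Definition prefix_elt n : P := cls (prefix_word n).

Lemma prefix_word0 : prefix_word 0 = [::].
Proof. by rewrite /prefix_word take0. Qed.
Lemma prefix_wordS (i : 'I_g) : prefix_word i.+1 = prefix_word i ++ comm_word i.
Proof.
rewrite /prefix_word (take_nth i) ?size_enum_ord // nth_ord_enum map_rcons.
by rewrite -cats1 flatten_cat.
Qed.
Lemma prefix_wordg : prefix_word g = relator g.
Proof. by rewrite /prefix_word -[X in take X]size_enum_ord take_size. Qed.

Lemma cls_comm i : cls (comm_word i) = comm_elt i.
Proof.
rewrite /comm_word !(cls_cons _ (_ :: _)).
by rewrite !cls_letter /= -/(gen_a i) -/(gen_b i) /comm_elt !mulgA.
Qed.

Lemma prefix_elt0 : prefix_elt 0 = 1.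
Proof. by rewrite /prefix_elt prefix_word0. Qed.
Lemma prefix_eltS (i : 'I_g) : prefix_elt i.+1 = prefix_elt i * comm_elt i.
Proof. by rewrite /prefix_elt prefix_wordS cls_cat cls_comm. Qed.
Lemma prefix_eltg : prefix_elt g = 1.
Proof. by rewrite /prefix_elt prefix_wordg cls_relator. Qed.

Lemma big_ltS (F : 'I_g -> bool) (i : 'I_g) :
  \big[addb/false]_(j < g | j < i.+1) F j
  = \big[addb/false]_(j < g | j < i) F j (+) F i.
Proof.
rewrite (bigD1 i) //= addbC; congr (_ (+) _); apply: eq_bigl => j.
by rewrite ltnS (ltn_neqAle j i) andbC.
Qed.

(* The positions of an edge labelled [s] in the boundary of the face based at
   [y] start at [y * pos1 s] and [y * pos2 s]. *)
Definition pos1 (s : gen) : P :=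
  if s.2 then prefix_elt s.1 * gen_a s.1 else prefix_elt s.1.
Definition pos2 (s : gen) : P :=
  if s.2 then prefix_elt s.1.+1
  else prefix_elt s.1 * gen_a s.1 * gen_b s.1 * (gen_a s.1)^-1.

Lemma path_sum_prefix f y n : n <= g -> path_sum f y (prefix_word n) =
  \big[addb/false]_(i < g | i < n)
     ((f (y * pos1 (i, false), (i, false)) (+) f (y * pos2 (i, false), (i, false)))
     (+) (f (y * pos1 (i, true), (i, true)) (+) f (y * pos2 (i, true), (i, true)))).
Proof.
elim: n => [|n IH] hn; first by rewrite prefix_word0 big_pred0.
rewrite (prefix_wordS (Ordinal hn)) path_sum_cat IH ?(ltnW hn) //.
rewrite (big_ltS _ (Ordinal hn)); congr (_ (+) _).
set i := Ordinal hn; rewrite -/(prefix_elt i) [in LHS]/path_sum /comm_word.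
rewrite /ledge /= !cls_letter /=.
rewrite -/(gen_a i) -/(gen_b i).
rewrite /pos1 /pos2 /= (prefix_eltS i : prefix_elt n.+1 = _) /comm_elt !mulgA !addbF.
by do 4!case: (f _).
Qed.

(** Each generator occurs exactly twice in the relator. Dually each edge has two faces, which is
    what makes the complex a surface modulo 2. *)
Lemma d1E f y : d1 f y =
  \big[addb/false]_s (f (y * pos1 s, s) (+) f (y * pos2 s, s)).
Proof.
rewrite /d1 -prefix_wordg path_sum_prefix //.
have e : (fun i : 'I_g => i < g) =1 xpredT by move=> i; rewrite ltn_ord.
rewrite (eq_bigl _ _ e) => {e}.
rewrite [RHS](eq_bigr (fun s : gen => (fun i k =>
   f (y * pos1 (i, k), (i, k)) (+) f (y * pos2 (i, k), (i, k))) s.1 s.2)); last by case.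
rewrite -(pair_bigA _ (fun i k =>
   f (y * pos1 (i, k), (i, k)) (+) f (y * pos2 (i, k), (i, k)))) /=.
by apply: eq_bigr => i _; rewrite big_bool /= addbC.
Qed.

End CayleyComplex.

(** * Dual paths *)

Definition finsupp (T : eqType) (A : T -> bool) : Prop :=
  exists l : seq T, forall y, A y -> y \in l.

Section FiniteSupport.
Variable T : eqType.
Implicit Types A B : T -> bool.

Lemma finsupp_sub A B : (forall y, A y -> B y) -> finsupp B -> finsupp A.
Proof. by move=> h [l hl]; exists l => y /h /hl. Qed.

Lemma finsuppD A B :
  finsupp A -> finsupp B -> finsupp (fun y => A y (+) B y).
Proof.
move=> [l hl] [m hm]; exists (l ++ m) => y; rewrite mem_cat.
case hA: (A y) => /= hB; first by rewrite (hl _ hA).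
by rewrite (hm _ hB) orbT.
Qed.

Lemma finsuppU A B :
  finsupp A -> finsupp B -> finsupp (fun y => A y || B y).
Proof.
move=> [l hl] [m hm]; exists (l ++ m) => y; rewrite mem_cat.
by case/orP=> [/hl -> | /hm ->]; rewrite ?orbT.
Qed.

Lemma finsupp0 : finsupp (fun _ : T => false).
Proof. by exists [::]. Qed.

Lemma finsupp1 (x : T) : finsupp (fun y => y == x).
Proof. by exists [:: x] => y /eqP ->; rewrite mem_head. Qed.

Lemma finsupp_big (I : Type) (r : seq I) (Q : pred I) (F : I -> T -> bool) :
  (forall i, finsupp (F i)) ->
  finsupp (fun y => \big[addb/false]_(i <- r | Q i) F i y).
Proof.
move=> hF; elim: r => [|i r IH].
  by exists [::] => y; rewrite big_nil.
have h := finsuppD (hF i) IH.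
apply: finsupp_sub (finsuppU h IH) => y; rewrite big_cons.
by case: (Q i) => [->|->]; rewrite ?orbT.
Qed.
End FiniteSupport.

Section Duality.
Variable g : nat.
Notation P := (pi1 g).
Notation gen := ('I_g * bool)%type.
Notation edge := (P * gen)%type.
Implicit Types (u v w : word g) (x y z : P) (f : edge -> bool) (A : P -> bool).

Definition ind (e0 : edge) : edge -> bool := fun e => e == e0.

(** The four edges of handle [i] at the vertex [z]. As a dual chain it turns around [z], from one
    face at [z] to another. *)
Definition star (i : 'I_g) z : edge -> bool := fun e =>
  (ind (z, (i, false)) e (+) ind (z * (gen_a i)^-1, (i, false)) e)
  (+) (ind (z, (i, true)) e (+) ind (z * (gen_b i)^-1, (i, true)) e).

(** A partial turn around [z] in the dual graph, from the face [z] to the face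
    [z * (prefix_elt g n)^-1]; for [n = g] the turn is complete. *)
Definition star_sum n z : edge -> bool := fun e =>
  \big[addb/false]_(j < g | j < n) star j z e.

(* A path in the dual graph from the face [y] to the face [y * gen_elt s]. *)
Definition dual_step (e0 : edge) : edge -> bool := fun e =>
  let: (y, (i, k)) := e0 in
  if k then
    (star_sum i.+1 y e (+) star_sum i (y * gen_b i) e)
    (+) ind (y * gen_b i, (i, false)) e
  else
    (star_sum i y e (+) star_sum i.+1 (y * gen_a i) e)
    (+) ind (y * gen_a i, (i, true)) e.

Definition dual_path y w : edge -> bool :=
  fun e => path_sum (fun e0 => dual_step e0 e) y w.

Lemma d1D f1 f2 y : d1 (fun e => f1 e (+) f2 e) y = d1 f1 y (+) d1 f2 y.
Proof. exact: path_sumD. Qed.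

Lemma eq_d1 f1 f2 y : f1 =1 f2 -> d1 f1 y = d1 f2 y.
Proof. exact: eq_path_sum. Qed.

Lemma d1_ind z s y :
  d1 (ind (z, s)) y = (y == z * (pos1 s)^-1) (+) (y == z * (pos2 s)^-1).
Proof.
rewrite d1E (bigD1 s) //= big1 => [|t ts].
  rewrite addbF /ind !xpair_eqE eqxx !andbT; congr (_ (+) _).
    by rewrite eq_sym -divg_eq eq_sym.
  by rewrite eq_sym -divg_eq eq_sym.
by rewrite /ind !xpair_eqE (negbTE ts) !andbF.
Qed.

Lemma d1_star i z y :
  d1 (star i z) y
  = (y == z * (prefix_elt g i)^-1) (+) (y == z * (prefix_elt g i.+1)^-1).
Proof.
rewrite /star !d1D !d1_ind /pos1 /pos2 /= prefix_eltS /comm_elt; gsimp; xor.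
Qed.

Lemma d1_big (I : Type) (r : seq I) (Q : pred I) (F : I -> edge -> bool) y :
  d1 (fun e => \big[addb/false]_(i <- r | Q i) F i e) y
  = \big[addb/false]_(i <- r | Q i) d1 (F i) y.
Proof.
elim: r => [|i r IH].
  rewrite big_nil -[RHS](path_sum0 y (relator g)).
  by apply: eq_path_sum => e; rewrite big_nil.
rewrite big_cons -IH; case hQ: (Q i).
  by rewrite -d1D; apply: eq_d1 => e; rewrite big_cons hQ.
by apply: eq_d1 => e; rewrite big_cons hQ.
Qed.

Lemma d1_star_sum n z y :
  n <= g -> d1 (star_sum n z) y = (y == z) (+) (y == z * (prefix_elt g n)^-1).
Proof.
rewrite /star_sum d1_big; elim: n => [|n IH] hn.
  by rewrite big_pred0 // prefix_elt0 invg1 mulg1 addbb.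
rewrite (big_ltS _ (Ordinal hn)) IH ?(ltnW hn) // d1_star /=; xor.
Qed.

Lemma d1_dual_step e0 y : d1 (dual_step e0) y = d0 (fun z => y == z) e0.
Proof.
case: e0 => z [i k]; rewrite /d0 /=; case: k.
  rewrite !d1D d1_ind !d1_star_sum ?ltn_ord ?(ltnW (ltn_ord i)) //.
  rewrite /pos1 /pos2 /= -/(gen_b i) prefix_eltS /comm_elt; gsimp; xor.
rewrite !d1D d1_ind !d1_star_sum ?ltn_ord ?(ltnW (ltn_ord i)) //.
rewrite /pos1 /pos2 /= -/(gen_a i) prefix_eltS /comm_elt; gsimp; xor.
Qed.

Lemma d1_dual_path y w z : d1 (dual_path y w) z = (z == y) (+) (z == y * cls w).
Proof.
rewrite /d1 /dual_path path_sum_exchange -(path_sum_d0 (fun x => z == x)).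
by apply: eq_path_sum => e; apply: d1_dual_step.
Qed.

Lemma dual_path_comm y i e :
  dual_path y (comm_word i) e = star_sum i y e (+) star_sum i.+1 (y * comm_elt i) e.
Proof.
rewrite /dual_path /comm_word /path_sum /ledge /= !cls_letter /=.
rewrite -/(gen_a i) -/(gen_b i).
rewrite /comm_elt; gsimp.
have h z : star_sum i.+1 z e = star_sum i z e (+) star i z e by exact: big_ltS.
rewrite (h (y * gen_a i * gen_b i)) /star; gsimp; xor.
Qed.

Lemma dual_path_cat y u v e :
  dual_path y (u ++ v) e = dual_path y u e (+) dual_path (y * cls u) v e.
Proof. exact: path_sum_cat. Qed.

Lemma dual_path_prefix y n e : n <= g ->
  dual_path y (prefix_word g n) e = star_sum n (y * prefix_elt g n) e.
Proof.
elim: n => [|n IH] hn; first by rewrite prefix_word0 /dual_path /= /star_sum big_pred0.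
rewrite (prefix_wordS (Ordinal hn)) dual_path_cat IH ?(ltnW hn) // dual_path_comm /=.
rewrite -/(prefix_elt g n) (prefix_eltS (Ordinal hn) : prefix_elt g n.+1 = _) /=.
gsimp; xor.
Qed.

(** The steps telescope to the full turn around the vertex [y]. So the relator loops of the dual
    graph surround the vertices: the complex is self-dual. *)
Lemma dual_path_relator y e : dual_path y (relator g) e = d0 (fun z => z == y) e.
Proof.
rewrite -prefix_wordg dual_path_prefix // prefix_eltg mulg1 /star_sum.
case: e => z [i k].
rewrite (bigD1 i) ?ltn_ord //= big1 => [|j /andP[_ ji]].
  rewrite addbF /star /ind /d0 !xpair_eqE eqxx /=.
  case: k => /=; rewrite ?andbT ?andbF /= ?addbF -/(gen_a i) -/(gen_b i);
    by rewrite -[in X in _ (+) X = _]divg_eq invgK.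
by rewrite /star /ind !xpair_eqE (eq_sym i) (negbTE ji) !andbF.
Qed.

End Duality.

(** * Finite cochains *)

Section FiniteSums.
Variable T : eqType.
Implicit Types (F : T -> bool) (l : seq T).

Lemma big_addb_eq (x : T) l :
  \big[addb/false]_(y <- l) (x == y) = odd (count_mem x l).
Proof.
elim: l => [|y l IH]; first by rewrite big_nil.
by rewrite big_cons IH /= oddD oddb eq_sym.
Qed.

Lemma big_addb_even l F :
  (forall y, odd (count_mem y l) = false) ->
  \big[addb/false]_(y <- l) F y = false.
Proof.
move=> h; rewrite -big_undup_iterop_count big1 // => y _.
have it n b : iterop n addb b false = odd n && b.
  case: n => // n; rewrite iteropS; elim: n => [|n IH]; first by case: b.
  by rewrite iterS IH /=; case: (odd n); case: b {IH}.
by rewrite it h.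
Qed.

Lemma big_addb_uniq l F : uniq l -> (forall y, F y -> y \in l) ->
  forall x, F x = \big[addb/false]_(y <- l | F y) (x == y).
Proof.
move=> ul hl x; rewrite -big_filter big_addb_eq.
rewrite count_uniq_mem ?filter_uniq // mem_filter oddb.
by case hF: (F x); rewrite ?(hl _ hF).
Qed.

(** The value on an infinite support is a convention. *)
Definition fsum F : bool :=
  if pselect (finsupp F) is left h
  then \big[addb/false]_(y <- undup (projT1 (cid h))) F y else false.

Lemma big_addb_supp l l' F : uniq l -> uniq l' ->
  (forall y, F y -> y \in l) -> (forall y, F y -> y \in l') ->
  \big[addb/false]_(y <- l) F y = \big[addb/false]_(y <- l') F y.
Proof.
have red m : \big[addb/false]_(y <- m) F y
           = \big[addb/false]_(y <- filter F m) F y.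
  by rewrite big_filter [RHS]big_mkcond; apply: eq_bigr => y _; case: (F y).
move=> ul ul' hl hl'; rewrite red [RHS]red; apply: perm_big.
apply: uniq_perm; rewrite ?filter_uniq // => y; rewrite !mem_filter.
by case hF: (F y); rewrite ?(hl _ hF) ?(hl' _ hF).
Qed.

Lemma fsumE l F : uniq l -> (forall y, F y -> y \in l) ->
  fsum F = \big[addb/false]_(y <- l) F y.
Proof.
move=> ul hl; rewrite /fsum; case: pselect => [h|[]]; last by exists l.
case: (cid h) => m hm /=; apply: big_addb_supp; rewrite ?undup_uniq // => y /hm.
by rewrite mem_undup.
Qed.

Lemma finsupp_uniq F : finsupp F ->
  exists2 l, uniq l & forall y, F y -> y \in l.
Proof.
case=> l hl; exists (undup l); rewrite ?undup_uniq // => y /hl.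
by rewrite mem_undup.
Qed.

Lemma finsupp_decomp F : finsupp F ->
  exists2 l, uniq l & forall x, F x = \big[addb/false]_(y <- l) (x == y).
Proof.
move=> /finsupp_uniq[l ul hl]; exists (filter F l); rewrite ?filter_uniq //.
by move=> x; rewrite big_filter; apply: big_addb_uniq.
Qed.

Lemma eq_fsum F1 F2 : F1 =1 F2 -> fsum F1 = fsum F2.
Proof. by move/funext ->. Qed.

Lemma fsumD F1 F2 : finsupp F1 -> finsupp F2 ->
  fsum (fun y => F1 y (+) F2 y) = fsum F1 (+) fsum F2.
Proof.
move=> /finsupp_uniq[l _ hl] /finsupp_uniq[m _ hm].
have u := undup_uniq (l ++ m).
have h1 y : F1 y -> y \in undup (l ++ m).
  by move=> /hl h; rewrite mem_undup mem_cat h.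
have h2 y : F2 y -> y \in undup (l ++ m).
  by move=> /hm h; rewrite mem_undup mem_cat h orbT.
rewrite (fsumE u h1) (fsumE u h2) -big_split; apply: fsumE => // y.
by case e1: (F1 y) => /= e2; [apply: h1 | apply: h2].
Qed.

Lemma fsum0 : fsum (fun _ : T => false) = false.
Proof. by rewrite (@fsumE [::]) ?big_nil. Qed.

Lemma fsum_delta (x : T) F : fsum (fun y => (y == x) && F y) = F x.
Proof.
rewrite (@fsumE [:: x]) //; last by move=> y /andP[/eqP -> _]; rewrite mem_head.
by rewrite big_seq1 eqxx.
Qed.

Lemma fsum_big (I : Type) (r : seq I) (F : I -> T -> bool) :
  (forall i, finsupp (F i)) ->
  fsum (fun y => \big[addb/false]_(i <- r) F i y)
  = \big[addb/false]_(i <- r) fsum (F i).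
Proof.
move=> hF; elim: r => [|i r IH].
  by rewrite big_nil -[RHS]fsum0; apply: eq_fsum => y; rewrite big_nil.
rewrite big_cons -IH -fsumD //; last exact: finsupp_big.
by apply: eq_fsum => y; rewrite big_cons.
Qed.
End FiniteSums.

Lemma finsupp_inj (T U : eqType) (h : T -> U) (F : U -> bool) :
  injective h -> finsupp F -> finsupp (F \o h).
Proof.
move=> ih [l hl].
exists (flatten [seq (if pselect (exists x, h x = y) is left e
                      then [:: projT1 (cid e)] else [::]) | y <- l]) => x /hl hx.
apply/flatten_mapP; exists (h x) => //.
case: pselect => [e|[]]; last by exists x.
by case: (cid e) => x' /= /ih ->; rewrite mem_head.
Qed.

Lemma fsum_reindex (T U : eqType) (h : T -> U) (F : U -> bool) :
  bijective h -> finsupp F -> fsum (F \o h) = fsum F.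
Proof.
move=> [k hk kh] /finsupp_uniq[l ul hl].
rewrite (fsumE ul hl).
have um : uniq (map k l) by rewrite map_inj_uniq //; exact: can_inj kh.
rewrite (@fsumE _ (map k l)) //; last first.
  by move=> y /= /hl hy; rewrite -[y]hk map_f.
by rewrite big_map; apply: eq_bigr => y _ /=; rewrite kh.
Qed.

(** * Cohomology with finite supports *)

Section FiniteCochains.
Variable g : nat.
Notation P := (pi1 g).
Notation gen := ('I_g * bool)%type.
Notation edge := (P * gen)%type.
Implicit Types (u v w : word g) (x y z : P) (f : edge -> bool) (A : P -> bool).

Definition finite_bnd f := exists2 A, finsupp A & forall e, f e = d0 A e.

Lemma finite_bndD f1 f2 :
  finite_bnd f1 -> finite_bnd f2 -> finite_bnd (fun e => f1 e (+) f2 e).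
Proof.
move=> [A fA hA] [B fB hB]; exists (fun y => A y (+) B y).
  exact: finsuppD.
by move=> e; rewrite hA hB /d0; xor.
Qed.

Lemma finite_bnd_ext f1 f2 : f1 =1 f2 -> finite_bnd f1 -> finite_bnd f2.
Proof. by move=> h [A fA hA]; exists A => // e; rewrite -h. Qed.

Lemma finite_bnd0 : finite_bnd (fun=> false).
Proof. by exists (fun=> false); first exact: finsupp0. Qed.

Lemma finite_bnd_big (I : Type) (r : seq I) (Q : pred I) (F : I -> edge -> bool) :
  (forall i, finite_bnd (F i)) ->
  finite_bnd (fun e => \big[addb/false]_(i <- r | Q i) F i e).
Proof.
move=> hF; elim: r => [|i r IH].
  by apply: finite_bnd_ext finite_bnd0 => e; rewrite big_nil.
case hQ: (Q i).
  by apply: finite_bnd_ext (finite_bndD (hF i) IH) => e; rewrite big_cons hQ.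
by apply: finite_bnd_ext IH => e; rewrite big_cons hQ.
Qed.

Lemma finsupp_ind (e0 : edge) : finsupp (ind e0).
Proof. exact: finsupp1. Qed.

Lemma finsupp_star_sum n z : finsupp (@star_sum g n z).
Proof.
by apply: finsupp_big => i; do !apply: finsuppD; apply: finsupp_ind.
Qed.

Lemma finsupp_dual_step (e0 : edge) : finsupp (dual_step e0).
Proof.
by case: e0 => y [i []]; do !apply: finsuppD;
  (apply: finsupp_star_sum || apply: finsupp_ind).
Qed.

Lemma finsupp_dual_path y w : finsupp (dual_path y w).
Proof.
elim: w y => [|l w IH] y; first exact: finsupp0.
by apply: finsuppD (IH _); apply: finsupp_dual_step.
Qed.

(** A free reduction changes nothing, and a relator contributes the coboundary of one vertex. Hence
    the class of a dual path depends only on its end points. *)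
Lemma dual_path_surf_rel u v y : surf_rel u v ->
  finite_bnd (fun e => dual_path y u e (+) dual_path y v e).
Proof.
move=> h; elim: h y => {u v} [u v st|u|u v _ IH|u v w _ IH1 _ IH2] y.
- case: st => [a b l|a b].
    apply: finite_bnd_ext finite_bnd0 => e.
    by rewrite !dual_path_cat {2}/dual_path path_sum_linv -/(dual_path _ _ _) addbb.
  exists (fun z => z == y * cls a); first exact: finsupp1.
  by move=> e; rewrite -dual_path_relator !dual_path_cat cls_relator mulg1; xor.
- by apply: finite_bnd_ext finite_bnd0 => e; rewrite addbb.
- by apply: finite_bnd_ext (IH y) => e; rewrite addbC.
- by apply: finite_bnd_ext (finite_bndD (IH1 y) (IH2 y)) => e; xor.
Qed.

Definition dual_from1 y : edge -> bool := dual_path 1 (rep y).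

Lemma finsupp_dual_from1 y : finsupp (dual_from1 y).
Proof. exact: finsupp_dual_path. Qed.

Lemma dual_path_from1 y w : finite_bnd (fun e =>
  dual_path y w e (+) (dual_from1 y e (+) dual_from1 (y * cls w) e)).
Proof.
have h : surf_rel (rep y ++ w) (rep (y * cls w)).
  by apply/cls_eqP; rewrite cls_cat !repK.
apply: finite_bnd_ext (dual_path_surf_rel 1 h) => e.
by rewrite dual_path_cat repK mul1g /dual_from1; xor.
Qed.

Lemma star_sum_dual_path n z e : n <= g ->
  star_sum n z e = dual_path (z * (prefix_elt g n)^-1) (prefix_word g n) e.
Proof. by move=> hn; rewrite dual_path_prefix // mulgVK. Qed.

Lemma ind_dual_from1 z s :
  finite_bnd (fun e => ind (z, s) e
    (+) (dual_from1 (z * (pos1 s)^-1) e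
         (+) dual_from1 (z * (pos2 s)^-1) e)).
Proof.
case: s => i k; have hi := ltn_ord i; have hi' := ltnW hi.
case: k.
(* A dual step labelled a_i crosses an edge labelled b_i, and conversely; hence the opposite
   letter. *)
- pose y := z * (gen_a i)^-1.
  apply: finite_bnd_ext (finite_bndD (dual_path_from1 y [:: ((i, false), false)])
    (finite_bndD (dual_path_from1 (y * (prefix_elt g i)^-1) (prefix_word g i))
          (dual_path_from1 (z * (prefix_elt g i.+1)^-1) (prefix_word g i.+1)))) => e.
  rewrite -!star_sum_dual_path // -/(prefix_elt g i) -/(prefix_elt g i.+1).
  rewrite -/(gen_a i) !mulgVK.
  rewrite /dual_path /= /ledge /= -/(gen_a i) /pos1 /pos2 /=.
  rewrite (_ : y * gen_a i = z) ?mulgVK // /y; gsimp; xor.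
pose y := z * (gen_b i)^-1.
apply: finite_bnd_ext (finite_bndD (dual_path_from1 y [:: ((i, true), false)])
  (finite_bndD (dual_path_from1 (y * (prefix_elt g i.+1)^-1) (prefix_word g i.+1))
        (dual_path_from1 (z * (prefix_elt g i)^-1) (prefix_word g i)))) => e.
rewrite -!star_sum_dual_path // -/(prefix_elt g i) -/(prefix_elt g i.+1).
rewrite -/(gen_b i) !mulgVK.
rewrite /dual_path /= /ledge /= -/(gen_b i) /pos1 /pos2 /=.
rewrite (_ : y * gen_b i = z) ?mulgVK // /y prefix_eltS /comm_elt; gsimp; xor.
Qed.

Definition face1 (e : edge) : P := e.1 * (pos1 e.2)^-1.
Definition face2 (e : edge) : P := e.1 * (pos2 e.2)^-1.

Lemma d1_supp f l y : (forall e, f e = \big[addb/false]_(e0 <- l) (e == e0)) ->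
  d1 f y = \big[addb/false]_(e0 <- l) ((y == face1 e0) (+) (y == face2 e0)).
Proof.
move=> hf; rewrite (eq_d1 y hf).
rewrite (@d1_big _ _ _ _ (fun e0 e => ind e0 e)).
by apply: eq_bigr => -[z s] _; rewrite d1_ind.
Qed.

(* One-endedness, in cohomological form: every edge is homologous to a
   difference of the dual paths [dual_from1], with the faces of the edge as end
   points, so a finite cocycle is homologous to zero. *)
Lemma finite_cocycle f : finsupp f -> (forall y, d1 f y = false) -> finite_bnd f.
Proof.
move=> ff cf; have [l ul hl] := finsupp_decomp ff.
have h := @finite_bnd_big _ l xpredT _ (fun e0 => ind_dual_from1 e0.1 e0.2).
apply: finite_bnd_ext h => e; rewrite big_split /= -[RHS]addbF; congr (_ (+) _).
  by rewrite hl; apply: eq_bigr => -[z s].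
rewrite big_split /=.
rewrite -(big_map face1 xpredT (fun y => dual_from1 y e)).
rewrite -(big_map face2 xpredT (fun y => dual_from1 y e)) -big_cat.
apply: big_addb_even => y.
rewrite -big_addb_eq big_cat !big_map.
by have := d1_supp y hl; rewrite cf big_split; apply: esym.
Qed.

(** Every edge is counted once at each of its two faces. *)
Lemma fsum_d1 f : finsupp f -> fsum (d1 f) = false.
Proof.
move=> ff; have [l ul hl] := finsupp_decomp ff.
rewrite (eq_fsum (fun y => d1_supp y hl)) fsum_big => [|e]; last first.
  by apply: finsuppD; apply: finsupp1.
apply: big1 => e _; rewrite fsumD; try exact: finsupp1.
have h1 (x : P) : fsum (fun y => y == x) = true.
  by rewrite -(fsum_delta x xpredT); apply: eq_fsum => y; rewrite andbT.
by rewrite !h1.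
Qed.

(** Each face of [h] is moved to the face 1 along [dual_from1]; only the parity of [h] remains
    there. *)
Lemma finite_coboundary (h : P -> bool) : finsupp h ->
  exists2 k, finsupp k & forall y, d1 k y = h y (+) (fsum h && (y == 1)).
Proof.
move=> fh; have [l ul hl] := finsupp_decomp fh.
exists (fun e => \big[addb/false]_(x <- l) dual_from1 x e).
  by apply: finsupp_big => x; apply: finsupp_dual_from1.
move=> y; rewrite d1_big.
under eq_bigr => x do rewrite d1_dual_path mul1g repK.
rewrite big_split /= -hl addbC; congr (_ (+) _).
rewrite (eq_fsum hl) fsum_big; last by move=> x; apply: finsupp1.
elim: (l) => [|x m IH]; first by rewrite !big_nil.
rewrite !big_cons IH.
have -> : fsum (fun y => y == x) = true.
  by rewrite -(fsum_delta x xpredT); apply: eq_fsum => z; rewrite andbT.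
by case: (y == 1); rewrite ?andbT ?andbF; xor.
Qed.

End FiniteCochains.

(** * Rays *)

Lemma fsum_true (T : eqType) (F : T -> bool) : fsum F -> exists y, F y.
Proof.
move=> h; apply: contrapT => hn; move: h.
rewrite (@eq_fsum _ _ (fun=> false)) ?fsum0 // => y.
by apply/negP => hy; apply: hn; exists y.
Qed.

Lemma seq_bound (T : eqType) (Q : T -> nat -> Prop) (r : seq T) :
  (forall k, k \in r -> exists M, forall n, Q k n -> n <= M) ->
  exists M, forall k n, k \in r -> Q k n -> n <= M.
Proof.
elim: r => [|k r IH] h; first by exists 0.
have [|M hM] := IH; first by move=> k' hk'; apply: h; rewrite inE hk' orbT.
have [|N hN] := h k; first exact: mem_head.
exists (maxn M N) => k' n; rewrite inE leq_max => /orP[/eqP -> /hN -> | hk' /hM -> //].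
by rewrite orbT.
Qed.

Lemma finsupp_ex (T G : eqType) (r : seq T) (F : T -> G -> Prop) :
  (forall k, k \in r -> finsupp (fun y => `[< F k y >])) ->
  finsupp (fun y => `[< exists2 k, k \in r & F k y >]).
Proof.
elim: r => [|k r IH] h.
  by exists [::] => y /asboolP[].
have h1 := h k (mem_head _ _).
have h2 : finsupp (fun y => `[< exists2 k, k \in r & F k y >]).
  by apply: IH => k' hk'; apply: h; rewrite inE hk' orbT.
apply: finsupp_sub (finsuppU h1 h2) => y /asboolP[k']; rewrite inE.
case/orP=> [/eqP -> hF | hk' hF]; apply/orP; [left|right]; apply/asboolP => //.
by exists k'.
Qed.

Section Rays.
Variable G : groupType.
Implicit Types (x y z h k : G) (U V A B : G -> bool).

Definition inford x := forall n, 0 < n -> x ^+ n <> 1.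

Definition sim x y := exists p q, [/\ 0 < p, 0 < q & x ^+ p = y ^+ q].

(* The subsets at bounded distance from the positive powers of [x]. *)
Definition ray x U :=
  exists K : seq G, forall y, U y -> exists n k, k \in K /\ y = x ^+ n * k.

Definition ray2 x y U := exists U1 U2,
  [/\ ray x U1, ray y U2 & forall z, U z -> U1 z || U2 z].

(** Families of negligible sets. Edges join [z] to [z * s], so invariance under right translation
    makes them stable under bounded neighbourhoods. *)
Record ideal (I : (G -> bool) -> Prop) : Prop := Ideal {
  ideal_sub : forall U V, (forall z, U z -> V z) -> I V -> I U;
  ideal_or : forall U V, I U -> I V -> I (fun z => U z || V z);
  ideal_tr : forall U h, I U -> I (fun z => U (z * h));
  ideal_fin : forall U, finsupp U -> I U }.

Lemma idealD I U V : ideal I -> I U -> I V -> I (fun z => U z (+) V z).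
Proof.
move=> hI hU hV; apply: (ideal_sub hI) (ideal_or hI hU hV) => z.
by case: (U z); case: (V z).
Qed.

Lemma ideal_big I (J : Type) (r : seq J) (Q : pred J) (F : J -> G -> bool) :
  ideal I -> (forall i, I (F i)) ->
  I (fun z => \big[addb/false]_(i <- r | Q i) F i z).
Proof.
move=> hI hF; elim: r => [|i r IH].
  by apply: (ideal_fin hI); exists [::] => z; rewrite big_nil.
apply: (ideal_sub hI) (ideal_or hI (idealD hI (hF i) IH) IH) => z.
by rewrite big_cons; case: (Q i) => ->; rewrite ?orbT.
Qed.

Lemma ray_ideal x : ideal (ray x).
Proof.
split.
- by move=> U V h [K hK]; exists K => y /h /hK.
- move=> U V [K hK] [L hL]; exists (K ++ L) => y.
  by case/orP=> [/hK|/hL] [n [k [hk ->]]]; exists n, k; rewrite mem_cat hk ?orbT.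
- move=> U h [K hK]; exists [seq k * h^-1 | k <- K] => y /hK[n [k [hk e]]].
  exists n, (k * h^-1); split; first exact: (map_f (fun k => k * h^-1)).
  by rewrite mulgA -e mulgK.
- by move=> U [l hl]; exists l => y /hl hy; exists 0, y; rewrite expg0 mul1g.
Qed.

Lemma ray2_ideal x y : ideal (ray2 x y).
Proof.
have rx := ray_ideal x; have ry := ray_ideal y; split.
- by move=> U V h [U1 [U2 [h1 h2 hV]]]; exists U1, U2; split=> // z /h /hV.
- move=> U V [U1 [U2 [h1 h2 hU]]] [V1 [V2 [k1 k2 hV]]].
  exists (fun z => U1 z || V1 z), (fun z => U2 z || V2 z).
  split; [exact: (ideal_or rx) | exact: (ideal_or ry) |].
  move=> z /orP[/hU|/hV] /orP[] ->; by rewrite ?orbT.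
- move=> U h [U1 [U2 [h1 h2 hU]]].
  exists (fun z => U1 (z * h)), (fun z => U2 (z * h)).
  by split=> [||z /hU]; [exact: (ideal_tr rx) | exact: (ideal_tr ry) |].
- move=> U hU; exists U, U; split=> [||z ->//].
    exact: (ideal_fin rx).
  exact: (ideal_fin ry).
Qed.

Lemma ray_ray2l x y U : ray x U -> ray2 x y U.
Proof.
move=> h; exists U, (fun=> false); split=> // [|z ->//].
by apply: (ideal_fin (ray_ideal y)); apply: finsupp0.
Qed.

Lemma ray_ray2r x y U : ray y U -> ray2 x y U.
Proof.
move=> h; exists (fun=> false), U; split=> //.
by apply: (ideal_fin (ray_ideal x)); apply: finsupp0.
Qed.

Lemma ray2C x y U : ray2 x y U -> ray2 y x U.
Proof.
by move=> [U1 [U2 [h1 h2 h]]]; exists U2, U1; split=> // z /h; rewrite orbC.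
Qed.

Lemma inford_inj x m n : inford x -> x ^+ m = x ^+ n -> m = n.
Proof.
move=> hx; wlog lt : m n / m <= n => [H e|].
  by case/orP: (leq_total m n) => h; [apply: H | apply/esym; apply: H].
move=> e; case: (ltngtP m n) lt => // lt _.
have : 0 < n - m by rewrite subn_gt0.
by move/hx; rewrite expgnFr ?(ltnW lt) // e mulgV.
Qed.

Lemma sim_refl x : sim x x.
Proof. by exists 1%N, 1%N. Qed.

Lemma sim_sym x y : sim x y -> sim y x.
Proof. by move=> [p [q [hp hq e]]]; exists q, p. Qed.

Lemma sim_trans y x z : sim x y -> sim y z -> sim x z.
Proof.
move=> [p [q [hp hq e]]] [p' [q' [hp' hq' e']]].
exists (p * p')%N, (q' * q)%N; rewrite !muln_gt0 hp hp' hq hq'; split=> //.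
by rewrite expgnA e expgnAC e' -expgnA.
Qed.

(** For fixed [k], [l], a solution of [x ^+ n * k = y ^+ m * l] with both exponents larger than in a
    given solution would yield a common positive power. So one exponent is bounded. *)
Lemma ray_disjoint x y U : inford x -> inford y -> ~ sim x y ->
  ray x U -> ray y U -> finsupp U.
Proof.
move=> hx hy ns [K hK] [L hL].
pose F (kl : G * G) z :=
  exists n m, z = x ^+ n * kl.1 /\ z = y ^+ m * kl.2.
have hF : finsupp (fun z => `[< exists2 kl, kl \in allpairs pair K L & F kl z >]).
  apply: finsupp_ex => -[k l] _.
  case: (pselect (exists z, F (k, l) z)) => [[z0 [n0 [m0 [/= e1 e2]]]]|no]; last first.
    by exists [::] => z /asboolP hz; case: no; exists z.
  exists ([seq x ^+ n * k | n <- iota 0 n0.+1] ++ [seq y ^+ m * l | m <- iota 0 m0.+1]).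
  move=> z /asboolP[n [m [f1 f2]]]; rewrite mem_cat; rewrite /= in f1 f2.
  case: (leqP n n0) => hn.
    by rewrite {1}f1 (map_f (fun n => x ^+ n * k)) // mem_iota add0n ltnS.
  case: (leqP m m0) => hm.
    by rewrite orbC {1}f2 (map_f (fun m => y ^+ m * l)) // mem_iota add0n ltnS.
  case: ns; exists (n - n0), (m - m0); rewrite !subn_gt0; split=> //.
  rewrite !expgnFr ?(ltnW hn) ?(ltnW hm) //.
  rewrite -[x ^+ n](mulgK k) -[y ^+ m](mulgK l) -f1 -f2.
  rewrite -[(x ^+ n0)^-1](mulVKg k) -[(y ^+ m0)^-1](mulVKg l) -!invgM -e1 -e2.
  by rewrite !mulgA !mulgVK.
apply: finsupp_sub hF => z hz; apply/asboolP.
have [n [k [hk e]]] := hK _ hz; have [m [l [hl e']]] := hL _ hz.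
by exists (k, l); [exact: allpairs_f | exists n, m].
Qed.

Lemma ray_powers z k : ray z (fun y => `[< exists n, y = z ^+ n * k >]).
Proof.
by exists [:: k] => y /asboolP[n ->]; exists n, k; rewrite mem_head.
Qed.

Lemma finsupp_powers z k U : inford z ->
  finsupp (fun y => U y && `[< exists n, y = z ^+ n * k >]) ->
  exists N, forall n, N <= n -> U (z ^+ n * k) = false.
Proof.
move=> hz [l hl].
have [|N hN] := @seq_bound G (fun y n => y = z ^+ n * k) l.
  move=> y _; case: (pselect (exists n, y = z ^+ n * k)) => [[m e]|no].
    by exists m => n; rewrite e => /mulIg /(inford_inj hz) ->.
  by exists 0 => n e; case: no; exists n.
exists N.+1 => n hn; apply/negP => hU.
have /hN : z ^+ n * k \in l.
  by apply: hl; rewrite hU; apply/asboolP; exists n.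
by move=> /(_ n erefl); rewrite leqNgt hn.
Qed.

Lemma ray_avoid x z k U : inford x -> inford z -> ~ sim z x -> ray x U ->
  exists N, forall n, N <= n -> U (z ^+ n * k) = false.
Proof.
move=> hx hz ns hU; apply: finsupp_powers => //.
apply: (ray_disjoint hz hx ns).
  by apply: (ideal_sub (ray_ideal z)) (ray_powers z k) => y /andP[].
by apply: (ideal_sub (ray_ideal x)) hU => y /andP[].
Qed.

Lemma ray2_avoid x y z k U : inford x -> inford y -> inford z ->
  ~ sim z x -> ~ sim z y -> ray2 x y U ->
  exists N, forall n, N <= n -> U (z ^+ n * k) = false.
Proof.
move=> hx hy hz n1 n2 [U1 [U2 [h1 h2 h]]].
have [N1 e1] := ray_avoid k hx hz n1 h1.
have [N2 e2] := ray_avoid k hy hz n2 h2.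
exists (maxn N1 N2) => n; rewrite geq_max => /andP[g1 g2].
by apply/negP => /h; rewrite e1 ?e2.
Qed.

End Rays.

(** * Cochains supported along a ray *)

Section ShiftSum.
Variable G : groupType.
Implicit Types (x y z : G) (h : G -> bool).

(** The inverse of 1 - [x] as a geometric series of left translations; near a ray of [x] only
    finitely many terms meet a given point. *)
Definition shift_sum x h : G -> bool :=
  fun y => fsum (fun m : nat => h ((x ^+ m)^-1 * y)).

Lemma finsupp_shift x h y : inford x -> ray x h ->
  finsupp (fun m : nat => h ((x ^+ m)^-1 * y)).
Proof.
move=> hx [K hK].
have [|M hM] := @seq_bound G (fun k n => y = x ^+ n * k) K.
  move=> k _; case: (pselect (exists n, y = x ^+ n * k)) => [[n e]|no].
    by exists n => m; rewrite e => /mulIg /(inford_inj hx) ->.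
  by exists 0 => m e; case: no; exists m.
exists (iota 0 M.+1) => m /hK[n [k [hk e]]].
rewrite mem_iota add0n ltnS; apply: leq_trans (leq_addr n m) _.
apply: (hM k) => //.
by rewrite expgnDr -mulgA -e mulVKg.
Qed.

Lemma shift_sumE x h y : inford x -> ray x h ->
  h y = shift_sum x h y (+) shift_sum x h (x^-1 * y).
Proof.
move=> hx hh; have [l hl] := finsupp_shift y hx hh.
rewrite /shift_sum; set F := fun m => _.
have [M hM] : exists M, forall m, F m -> m < M.
  exists (\max_(i <- l) i).+1 => m /hl hm.
  by rewrite ltnS (big_rem m hm) leq_maxl.
have F0 : F 0 = h y by rewrite /F expg0 invg1 mul1g.
have FS m : h ((x ^+ m)^-1 * (x^-1 * y)) = F m.+1.
  by rewrite /F expgS invgM mulgA.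
rewrite (@fsumE _ (iota 0 M.+1)) ?iota_uniq //; last first.
  by move=> m /hM; rewrite mem_iota add0n /= ltnS => /ltnW.
rewrite (@fsumE _ (iota 0 M)) ?iota_uniq //; last first.
  by move=> m; rewrite FS => /hM /ltnW; rewrite mem_iota.
rewrite /= big_cons F0 -[1%N]addn0 iotaDl big_map.
under [X in _ (+) X]eq_bigr => m _ do rewrite FS.
by rewrite -addbA addbb addbF.
Qed.

Lemma ray_shift_sum x h : ray x h -> ray x (shift_sum x h).
Proof.
move=> [K hK]; exists K => y /fsum_true[m /hK[n [k [hk e]]]].
by exists (m + n)%N, k; split=> //; rewrite expgnDr -mulgA -e mulVKg.
Qed.

Definition tame h (F : G -> G -> bool) :=
  exists L : seq G, forall y z, h y -> F y z -> y^-1 * z \in L.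

Lemma tame_finsupp h F z : tame h F -> finsupp (fun y => h y && F y z).
Proof.
move=> [L hL]; exists [seq z * l^-1 | l <- L] => y /andP[h1 h2].
apply/mapP; exists (y^-1 * z); first exact: hL.
by rewrite invgM invgK mulVKg.
Qed.

Lemma tame_ray x h F : ray x h -> tame h F ->
  ray x (fun z => fsum (fun y => h y && F y z)).
Proof.
move=> [K hK] [L hL]; exists [seq k * l | k <- K, l <- L] => z.
move=> /fsum_true[y /andP[h1 h2]]; have [n [k [hk e]]] := hK _ h1.
exists n, (k * (y^-1 * z)); split; first by apply: allpairs_f => //; apply: hL.
by rewrite mulgA -e mulVKg.
Qed.

End ShiftSum.

(** * Vanishing of cohomology along a ray *)

Section RayCohomology.
Variable g : nat.
Notation P := (pi1 g).
Notation gen := ('I_g * bool)%type.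
Notation edge := (P * gen)%type.
Implicit Types (u v w : word g) (x y z : P) (f : edge -> bool) (A : P -> bool).

Definition supported (I : (P -> bool) -> Prop) f := forall s, I (fun y => f (y, s)).

Lemma dual_path_translate x y w z s :
  dual_path (x * y) w (x * z, s) = dual_path y w (z, s).
Proof.
have hind a b t t' : ind (x * a, t) (x * b, t') = ind (a, t) (b, t') :> bool.
  by rewrite /ind !xpair_eqE (inj_eq (mulgI x)).
have hS n a b t : star_sum n (x * a) (x * b, t) = star_sum n a (b, t).
  by apply: eq_bigr => i _; rewrite /star -!mulgA !hind.
rewrite /dual_path -path_sum_translate; apply: eq_path_sum => -[a [i k]] /=.
by rewrite -!mulgA !hS !hind.
Qed.

(** A dual path from the face [y] to the face [x * y]. *)
Definition conj_path x y : edge -> bool := dual_path y (rep (y^-1 * x * y)).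

Lemma d1_conj_path x y z : d1 (conj_path x y) z = (y == z) (+) (y == x^-1 * z).
Proof.
rewrite d1_dual_path repK !mulgA mulgV mul1g; congr (_ (+) _); first exact: eq_sym.
by rewrite -(inj_eq (mulgI x^-1)) mulKg eq_sym.
Qed.

Lemma conj_path_translate x y m z s :
  conj_path x (y * m) (z, s)
  = dual_path m (rep (m^-1 * (y^-1 * x * y) * m)) (y^-1 * z, s).
Proof.
rewrite /conj_path -[in RHS](dual_path_translate y) mulVKg.
by rewrite invgM !mulgA.
Qed.

(** For [y = x ^+ n * k] the conjugate [y^-1 * x * y] equals [k^-1 * x * k], so along the ray only
    finitely many paths occur up to left translation. *)
Lemma tame_conj_path x h m s : ray x h ->
  tame h (fun y z => conj_path x (y * m) (z, s)).
Proof.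
move=> [Kl hK].
have : finsupp (fun z => `[< exists2 k, k \in Kl &
   dual_path m (rep (m^-1 * (k^-1 * x * k) * m)) (z, s) >]).
  apply: finsupp_ex => k _.
  have [l hl] := finsupp_dual_path m (rep (m^-1 * (k^-1 * x * k) * m)).
  by exists (map fst l) => z /asboolP /hl h1; apply/mapP; exists (z, s).
move=> [L hL]; exists L => y z /hK[n [k [hk e]]]; rewrite conj_path_translate.
move=> hz; apply: hL; apply/asboolP; exists k => //.
have -> : k^-1 * x * k = y^-1 * x * y; last by [].
rewrite e invgM -!mulgA; congr (_ * _).
by rewrite !mulgA -[in RHS](mulgA _ x) -expgS expgSr !mulgA mulVg mul1g.
Qed.

Lemma path_sum_fsum (h : P -> bool) (F : P -> edge -> bool) z w :
  (forall e, finsupp (fun y => h y && F y e)) ->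
  finsupp (fun y => h y && path_sum (F y) z w) /\
  path_sum (fun e => fsum (fun y => h y && F y e)) z w
  = fsum (fun y => h y && path_sum (F y) z w).
Proof.
move=> hF; elim: w z => [|l w IH] z /=.
  split; first by exists [::] => y; rewrite andbF.
  by rewrite -[LHS](fsum0 P); apply: eq_fsum => y; rewrite andbF.
have [h1 h2] := IH (z * cls [:: l]); rewrite h2 -fsumD //.
split; last by apply: eq_fsum => y; case: (h y).
by apply: finsupp_sub (finsuppD (hF (ledge z l)) h1) => y; case: (h y).
Qed.

(** Let [k] be the shift sum of [h] and join each face [y] of [k] to [x * y]. The end points of
    these paths add up to [k] plus its translate, which is [h]. *)
Lemma ray_coboundary x (h : P -> bool) : inford x -> ray x h ->
  exists2 f, supported (ray x) f & forall z, d1 f z = h z.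
Proof.
move=> hx hh; pose k := shift_sum x h; have rk := ray_shift_sum hh.
have tm s := tame_conj_path 1 s rk.
have hF (e : edge) : finsupp (fun y => k y && conj_path x y e).
  case: e => z s; apply: finsupp_sub (tame_finsupp z (tm s)) => y.
  by rewrite mulg1.
exists (fun e => fsum (fun y => k y && conj_path x y e)).
  move=> s; apply: (ideal_sub (ray_ideal x)) (tame_ray rk (tm s)) => z.
  by under [in X in _ -> X]eq_fsum do rewrite mulg1.
move=> z; rewrite [LHS](proj2 (path_sum_fsum z (relator g) hF)).
rewrite (shift_sumE z hx hh) -/k.
under eq_fsum => y do rewrite -/(d1 _ z) d1_conj_path andb_addr ![k y && _]andbC.
have fd a : finsupp (fun y => (y == a) && k y).
  by apply: finsupp_sub (finsupp1 a) => y /andP[].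
by rewrite fsumD ?fsum_delta.
Qed.

Lemma d1_shift_sum x f z : inford x -> supported (ray x) f ->
  (forall y, d1 f y = false) ->
  d1 (fun e => shift_sum x (fun y => f (y, e.2)) e.1) z = false.
Proof.
move=> hx hf cf; rewrite d1E /=.
have fs y s : finsupp (fun m : nat => f ((x ^+ m)^-1 * y, s)).
  exact: (finsupp_shift y hx (hf s)).
under eq_bigr => s _.
  rewrite /shift_sum -fsumD //.
  over.
rewrite -fsum_big => [|s]; last exact: finsuppD.
rewrite -[RHS](fsum0 nat); apply: eq_fsum => m.
under eq_bigr => s _ do rewrite !mulgA.
by rewrite -d1E cf.
Qed.

(** The edge [(1, s)], its translate by [w], and dual paths from the two faces of the first to the
    corresponding faces of the second. *)
Definition conj_chain (w : P) (s : gen) : edge -> bool := fun e =>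
  (ind (1, s) e (+) ind (w, s) e)
  (+) (dual_path (pos1 s)^-1 (rep (pos1 s * w * (pos1 s)^-1)) e
       (+) dual_path (pos2 s)^-1 (rep (pos2 s * w * (pos2 s)^-1)) e).

Lemma conj_chain_finite_bnd (w : P) s : finite_bnd (conj_chain w s).
Proof.
apply: finite_cocycle.
  apply: finsuppD; apply: finsuppD; (apply: finsupp_ind || apply: finsupp_dual_path).
by move=> y; rewrite !d1D !d1_dual_path !d1_ind !repK; gsimp; xor.
Qed.

(** The shift sum [E] is a cocycle and [f] is [E] plus its translate. Each edge of [E] is homologous
    to its translate up to dual paths at its two faces, and over all edges these paths cancel since
    [d1 E] vanishes. *)
Lemma ray_cocycle x f : inford x -> supported (ray x) f ->
  (forall y, d1 f y = false) ->
  exists2 A, ray x A & forall e, f e = d0 A e.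
Proof.
move=> hx hf cf.
pose E e := shift_sum x (fun y => f (y, e.2)) e.1.
have rE s : ray x (fun y => E (y, s)) by exact: (ray_shift_sum (hf s)).
have cE z : d1 E z = false by exact: d1_shift_sum.
have EE z s : f (z, s) = E (z, s) (+) E (x^-1 * z, s).
  exact: (shift_sumE z hx (hf s)).
(* A finite set with coboundary [conj_chain w s]; [Bx] below moves it to the edge [(y, s)] and its
   translate by [x]. *)
pose B (w : P) s := projT1 (cid2 (conj_chain_finite_bnd w s)).
have fB (w : P) s : finsupp (B w s) by rewrite /B; case: cid2.
have dB (w : P) s e : d0 (B w s) e = conj_chain w s e by rewrite /B; case: cid2.
pose Bx s y z := B (y^-1 * x * y) s (y^-1 * z).
have tB s : tame (fun y => E (y, s)) (Bx s).
  have [Kl hK] := rE s.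
  have : finsupp (fun z => `[< exists2 k, k \in Kl & B (k^-1 * x * k) s z >]).
    apply: finsupp_ex => k _; apply: finsupp_sub (fB (k^-1 * x * k) s) => z.
    by move/asboolP.
  move=> [L hL]; exists L => y z /hK[n [k [hk e]]] hz.
  apply: hL; apply/asboolP; exists k => //.
  have -> : k^-1 * x * k = y^-1 * x * y; last by [].
  rewrite e invgM -!mulgA; congr (_ * _).
  by rewrite !mulgA -[in RHS](mulgA _ x) -expgS expgSr !mulgA mulVg mul1g.
exists (fun z => \big[addb/false]_s fsum (fun y => E (y, s) && Bx s y z)).
  by apply: ideal_big => [|s]; [exact: ray_ideal | exact: tame_ray].
have fE z s : finsupp (fun y => E (y, s) && Bx s y z) by exact: tame_finsupp.
case=> z t; rewrite EE /d0 /= -big_split /=.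
pose cp y := conj_path x y (z, t).
have fcp m s : finsupp (fun y => E (y, s) && cp (y * m)).
  exact: (tame_finsupp z (tame_conj_path m t (rE s))).
have fd s a : finsupp (fun y => (y == a) && (E (y, s) && (s == t))).
  by apply: finsupp_sub (finsupp1 a) => y /andP[].
have fM s m : finsupp (fun y => E (y * m, s) && cp y).
  apply: (@finsupp_sub _ _
    ((fun y => E (y, s) && cp (y * m^-1)) \o (fun y => y * m))).
    by move=> y /=; rewrite mulgK.
  by apply: finsupp_inj (fcp _ _); apply: mulIg.
(* The dual paths are indexed by faces instead of edges, to collect the coefficients of each
   face. *)
have reidx s m : fsum (fun y => E (y, s) && cp (y * m^-1))
               = fsum (fun y => E (y * m, s) && cp y).
  rewrite -(fsum_reindex (h := fun y => y * m)) //=.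
    by apply: eq_fsum => y /=; rewrite mulgK.
  by exists (fun y => y * m^-1) => y; rewrite ?mulgK ?mulgVK.
have step s : fsum (fun y => E (y, s) && Bx s y z)
      (+) fsum (fun y => E (y, s) && Bx s y (z * gen_elt t))
  = ((E (z, s) (+) E (x^-1 * z, s)) && (s == t))
    (+) (fsum (fun y => E (y * pos1 s, s) && cp y)
         (+) fsum (fun y => E (y * pos2 s, s) && cp y)).
  rewrite -fsumD // andb_addl -!reidx.
  rewrite -(fsum_delta z (fun y => E (y, s) && (s == t))).
  rewrite -(fsum_delta (x^-1 * z) (fun y => E (y, s) && (s == t))).
  rewrite -!fsumD //; try exact: finsuppD.
  apply: eq_fsum => y; rewrite /Bx mulgA -andb_addr.
  have -> : B (y^-1 * x * y) s (y^-1 * z) (+) B (y^-1 * x * y) s (y^-1 * z * gen_elt t)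
    = conj_chain (y^-1 * x * y) s (y^-1 * z, t) by rewrite -dB.
  rewrite /conj_chain /cp !conj_path_translate !invgK /ind !xpair_eqE.
  rewrite (_ : (y^-1 * z == 1) = (y == z)); last first.
    by rewrite mulg_eq1 eqg_inv.
  rewrite (_ : (y^-1 * z == y^-1 * x * y) = (y == x^-1 * z)); last first.
    by rewrite -mulgA (inj_eq (mulgI _)) -[in RHS](inj_eq (mulgI x)) mulVKg eq_sym.
  by rewrite (eq_sym t); case: (E (y, s)); rewrite ?andbF //= ?andbT; xor.
rewrite (eq_bigr _ (fun s _ => step s)) big_split /= -[LHS]addbF; congr (_ (+) _).
  by rewrite (bigD1 t) //= eqxx andbT big1 ?addbF // => s /negbTE ->; rewrite andbF.
under eq_bigr => s _ do rewrite -fsumD //.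
rewrite -fsum_big => [|s]; last exact: finsuppD.
(* The coefficient of the path at the face [y] is [d1 E y]. *)
rewrite -[LHS](fsum0 P); apply: eq_fsum => y.
under eq_bigr => s _ do rewrite -andb_addl andbC.
by rewrite -big_distrr /= -d1E cE andbF.
Qed.

End RayCohomology.

(** * Half-planes and separation *)

Section Separation.
Variable g : nat.
Notation P := (pi1 g).
Notation gen := ('I_g * bool)%type.
Notation edge := (P * gen)%type.
Implicit Types (x y z a b c d : P) (f : edge -> bool) (A B C : P -> bool).
Implicit Types I : (P -> bool) -> Prop.

(** Follows a word for [h] letter by letter. This frees the condition on [d0 A] from the choice of
    generators. *)
Lemma supported_translate I A h : ideal I -> supported I (d0 A) ->
  I (fun y => A y (+) A (y * h)).
Proof.
move=> hI hA; rewrite -[h]repK; elim: (rep h) => [|l w IH].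
  by apply: (ideal_fin hI); exists [::] => y; rewrite cls_nil mulg1 addbb.
have hl : I (fun y => A y (+) A (y * cls [:: l])).
  case: l => s []; rewrite cls_letter /=; last exact: hA.
  apply: (ideal_sub hI) (ideal_tr hI (gen_elt s)^-1 (hA s)) => y.
  by rewrite /d0 /= mulgVK addbC.
apply: (ideal_sub hI) (idealD hI hl (ideal_tr hI (cls [:: l]) IH)) => y.
rewrite (cls_cons l w) mulgA; apply: etrans; xor.
Qed.

Lemma supported_d0 I A : ideal I -> I A -> supported I (d0 A).
Proof. by move=> hI hA s; apply: idealD => //; exact: (ideal_tr hI (gen_elt s) hA). Qed.

Lemma supported_d1 I f : ideal I -> supported I f -> I (d1 f).
Proof.
move=> hI hf.
have h := @ideal_big _ I _ (index_enum _) xpredT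
  (fun s y => f (y * pos1 s, s) (+) f (y * pos2 s, s)) hI.
apply: (ideal_sub hI) (h _) => [y|s]; first by rewrite d1E.
by apply: idealD => //;
  [exact: (ideal_tr hI (pos1 s) (hf s)) | exact: (ideal_tr hI (pos2 s) (hf s))].
Qed.

Lemma supportedD I f1 f2 : ideal I -> supported I f1 -> supported I f2 ->
  supported I (fun e => f1 e (+) f2 e).
Proof. by move=> hI h1 h2 s; apply: idealD. Qed.

Lemma supported_fin I f : ideal I -> finsupp f -> supported I f.
Proof.
move=> hI [l hl] s; apply: (ideal_fin hI); exists (map fst l) => y /hl hy.
by apply/mapP; exists (y, s).
Qed.

Lemma supported_ext I f1 f2 : f1 =1 f2 -> supported I f1 -> supported I f2.
Proof. by move=> /funext ->. Qed.

Lemma d0_inj A B : (forall e, d0 A e = d0 B e) ->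
  exists c : bool, forall y, A y = B y (+) c.
Proof.
move=> h; exists (A 1 (+) B 1) => y.
have e1 := path_sum_d0 A 1 (rep y); have e2 := path_sum_d0 B 1 (rep y).
rewrite (eq_path_sum _ _ h) e2 repK mul1g in e1.
by move: e1; case: (A 1); case: (B 1); case: (A y); case: (B y).
Qed.

Lemma supported_split x y f : supported (ray2 x y) f -> exists f1 f2,
  [/\ supported (ray x) f1, supported (ray y) f2 & forall e, f e = f1 e (+) f2 e].
Proof.
move=> hf.
pose U1 s := projT1 (cid (hf s)).
exists (fun e => f e && U1 e.2 e.1), (fun e => f e && ~~ U1 e.2 e.1); split.
- move=> s; rewrite /U1 /=; case: (cid _) => V1 [V2 [h1 h2 h]] /=.
  by apply: (ideal_sub (ray_ideal x)) h1 => z /andP[].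
- move=> s; rewrite /U1 /=; case: (cid _) => V1 [V2 [h1 h2 h]] /=.
  by apply: (ideal_sub (ray_ideal y)) h2 => z /andP[/h/orP[->|->]].
by move=> e; case: (f e); case: (U1 _ _).
Qed.

(** By [ray_cocycle] the coboundary is that of a set near the ray, and sets with the same coboundary
    are equal or complementary. *)
Lemma ray_dichotomy x A : inford x -> supported (ray x) (d0 A) ->
  ray x A \/ ray x (fun y => ~~ A y).
Proof.
move=> hx hA; have [B rB hB] := ray_cocycle hx hA (d1_d0 A).
have [c hc] := d0_inj hB; case: c hc => hc; [right|left].
  by apply: (ideal_sub (ray_ideal x)) rB => y; rewrite hc addbT negbK.
by apply: (ideal_sub (ray_ideal x)) rB => y; rewrite hc addbF.
Qed.

(** The half-planes bounded by the ends of [x] and [y]. *)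
Definition nontriv x y A :=
  [/\ supported (ray2 x y) (d0 A), ~ ray2 x y A & ~ ray2 x y (fun z => ~~ A z)].

Section Pair.
Variables x y : P.
Hypotheses (hx : inford x) (hy : inford y) (nxy : ~ sim x y).

(** Since [d1 (d0 A)] vanishes, the two parts have the same boundary; it lies near both rays and is
    therefore finite. *)
Lemma split_finsupp A f1 f2 : supported (ray x) f1 -> supported (ray y) f2 ->
  (forall e, d0 A e = f1 e (+) f2 e) ->
  finsupp (d1 f1) /\ (forall z, d1 f1 z = d1 f2 z).
Proof.
move=> h1 h2 h.
have e z : d1 f1 z = d1 f2 z.
  by apply: addb_cancel; rewrite -d1D -(eq_d1 z h) d1_d0.
split=> //; apply: (ray_disjoint hx hy nxy).
  exact: supported_d1 (ray_ideal x) h1.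
apply: (ideal_sub (ray_ideal y)) (supported_d1 (ray_ideal y) h2) => z.
by rewrite e.
Qed.

(** If the parity were even, one finite chain [k] would close up both [f1] and [f2]. Each would then
    bound a set near its own ray, making [A] or its complement trivial. *)
Lemma nontriv_odd A f1 f2 : supported (ray x) f1 -> supported (ray y) f2 ->
  (forall e, d0 A e = f1 e (+) f2 e) -> nontriv x y A -> fsum (d1 f1) = true.
Proof.
move=> h1 h2 h [_ n1 n2]; have [fin e] := split_finsupp h1 h2 h.
apply/negPn/negP => /negbTE ev0.
have [k fk hk] := finite_coboundary fin; rewrite ev0 in hk.
have [|z|A1 r1 e1] := @ray_cocycle _ x (fun e => f1 e (+) k e) hx.
- by apply: (supportedD (ray_ideal x) h1); apply: (supported_fin (ray_ideal x) fk).
- by rewrite d1D hk andFb addbF addbb.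
have [|z|A2 r2 e2] := @ray_cocycle _ y (fun e => f2 e (+) k e) hy.
- by apply: (supportedD (ray_ideal y) h2); apply: (supported_fin (ray_ideal y) fk).
- by rewrite d1D hk -e andFb addbF addbb.
have [c hc] : exists c : bool, forall z, A z = (A1 z (+) A2 z) (+) c.
  apply: d0_inj => z; rewrite h.
  have -> : f1 z (+) f2 z = (f1 z (+) k z) (+) (f2 z (+) k z) by xor.
  by rewrite e1 e2 /d0; xor.
have r12 : ray2 x y (fun z => A1 z (+) A2 z).
  by apply: (idealD (ray2_ideal x y)); [apply: ray_ray2l | apply: ray_ray2r].
case: c hc => hc; [apply: n2 | apply: n1];
  apply: (ideal_sub (ray2_ideal x y)) r12 => z; rewrite hc.
  by rewrite addbT negbK.
by rewrite addbF.
Qed.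

(* The face at 1 is pushed to infinity along each of the two rays; the
   difference of the two ways of doing so is the coboundary of [A]. *)
Lemma nontriv_exists : exists A, nontriv x y A.
Proof.
have rf z : ray z (fun u : P => u == 1).
  by apply: (ideal_fin (ray_ideal z)); apply: finsupp1.
have [f1 s1 h1] := ray_coboundary hx (rf x).
have [f2 s2 h2] := ray_coboundary hy (rf y).
have [|A hA] := @cocycle_coboundary g (fun e => f1 e (+) f2 e).
  by move=> z; rewrite d1D h1 h2 addbb.
have dA : supported (ray2 x y) (d0 A).
  apply: (supported_ext hA); apply: (supportedD (ray2_ideal x y)) => s.
    exact: ray_ray2l.
  exact: ray_ray2r.
(* Splitting such a [B] into parts near one ray each would produce a finite chain [k] whose boundary
   is the single face 1, against [fsum_d1]. *)
have key B : (forall e, d0 B e = d0 A e) -> ~ ray2 x y B.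
  move=> hB [U1 [U2 [r1 r2 hU]]].
  pose A1 z := B z && U1 z; pose A2 z := B z && ~~ U1 z.
  have rA1 : ray x A1 by apply: (ideal_sub (ray_ideal x)) r1 => z /andP[].
  have rA2 : ray y A2.
    by apply: (ideal_sub (ray_ideal y)) r2 => z /andP[/hU/orP[->|->]].
  pose k e := f1 e (+) d0 A1 e.
  have ek e : k e = f2 e (+) d0 A2 e.
    have h : d0 A1 e (+) d0 A2 e = f1 e (+) f2 e.
      rewrite hA -hB /d0 /A1 /A2.
      by case: (B e.1); case: (B _); case: (U1 e.1); case: (U1 _).
    rewrite /k; move: h; set p := d0 A1 e; set q := d0 A2 e.
    by case: p; case: q; case: (f1 e); case: (f2 e).
  have fk : finsupp k.
    have fs s : finsupp (fun z => k (z, s)).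
      apply: (ray_disjoint hx hy nxy).
        exact: (supportedD (ray_ideal x) s1 (supported_d0 (ray_ideal x) rA1)).
      apply: (ideal_sub (ray_ideal y))
        (supportedD (ray_ideal y) s2 (supported_d0 (ray_ideal y) rA2) s) => z.
      by rewrite ek.
    pose L s := projT1 (cid (fs s)).
    exists [seq (z, s) | s <- enum {: gen}, z <- L s] => -[z s] hz.
    apply/allpairsPdep; exists s, z; split=> //; first by rewrite mem_enum.
    by rewrite /L; case: (cid _) => l hl /=; apply: hl.
  have := fsum_d1 fk.
  have -> : d1 k = (fun u => u == 1).
    by apply: funext => z; rewrite /k d1D h1 d1_d0 addbF.
  rewrite (_ : fsum _ = true) //.
  rewrite -(fsum_delta (1 : P) xpredT).
  by apply: eq_fsum => z; rewrite andbT.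
exists A; split=> //; first exact: key.
by apply: key => e; rewrite /d0; xor.
Qed.

End Pair.

(** The parts of both coboundaries near [a] are odd, so their sum becomes a cocycle after a finite
    correction. It bounds a set [F] near [a], and adding [F] clears the end [a]. *)
Lemma nontriv_merge a b c A B : inford a -> inford b -> inford c ->
  ~ sim a b -> ~ sim a c -> nontriv a b A -> nontriv a c B ->
  exists2 F, ray a F &
    supported (ray2 b c) (d0 (fun z => A z (+) B z (+) F z)).
Proof.
move=> ha hb hc nab nac nA nB.
have [f1 [f2 [s1 s2 hA]]] := supported_split (let: And3 h _ _ := nA in h).
have [h1 [h2 [t1 t2 hB]]] := supported_split (let: And3 h _ _ := nB in h).
have o1 := nontriv_odd ha hb nab s1 s2 hA nA.
have o2 := nontriv_odd ha hc nac t1 t2 hB nB.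
have [fin1 _] := split_finsupp ha hb nab s1 s2 hA.
have [fin2 _] := split_finsupp ha hc nac t1 t2 hB.
have [k fk hk] := finite_coboundary (finsuppD fin1 fin2).
rewrite fsumD // o1 o2 in hk.
have [|z|F rF hF] := @ray_cocycle _ a (fun e => f1 e (+) h1 e (+) k e) ha.
- apply: (supportedD (ray_ideal a)); last exact: (supported_fin (ray_ideal a) fk).
  exact: (supportedD (ray_ideal a)).
- by rewrite !d1D hk andFb addbF addbb.
exists F => //.
have : supported (ray2 b c) (fun e => f2 e (+) h2 e (+) k e).
  apply: (supportedD (ray2_ideal b c)); last exact: (supported_fin (ray2_ideal b c) fk).
  by apply: (supportedD (ray2_ideal b c)) => s; [apply: ray_ray2l | apply: ray_ray2r].
apply: supported_ext => e.
have -> : d0 (fun z => A z (+) B z (+) F z) e = d0 A e (+) d0 B e (+) d0 F e.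
  by rewrite /d0; xor.
by rewrite hA hB -hF; xor.
Qed.

(** The eventual value of [A] at an end; asking for it on all parallels [z ^+ n * k] makes it depend
    only on the end of [z]. *)
Definition side A z (v : bool) :=
  forall k, exists N, forall n, N <= n -> A (z ^+ n * k) = v.

Lemma side_uniq A z v v' : side A z v -> side A z v' -> v = v'.
Proof.
move=> /(_ 1)[N h] /(_ 1)[N' h'].
by rewrite -(h (maxn N N')) ?leq_maxl // h' ?leq_maxr.
Qed.

Lemma sideN A z v : side A z v -> side (fun y => ~~ A y) z (~~ v).
Proof. by move=> h k; have [N hN] := h k; exists N => n /hN ->. Qed.

Lemma sideD A B z v w : side A z v -> side B z w ->
  side (fun y => A y (+) B y) z (v (+) w).
Proof.
move=> h1 h2 k; have [N hN] := h1 k; have [M hM] := h2 k.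
exists (maxn N M) => n; rewrite geq_max => /andP[l1 l2].
by rewrite hN ?hM.
Qed.

Lemma sideI A B z v w : side A z v -> side B z w ->
  side (fun y => A y && B y) z (v && w).
Proof.
move=> h1 h2 k; have [N hN] := h1 k; have [M hM] := h2 k.
exists (maxn N M) => n; rewrite geq_max => /andP[l1 l2].
by rewrite hN ?hM.
Qed.

Lemma side_ray x z A : inford x -> inford z -> ~ sim z x -> ray x A ->
  side A z false.
Proof. by move=> hx hz n hA k; apply: ray_avoid hA. Qed.

Lemma side_ray2 x y z A : inford x -> inford y -> inford z ->
  ~ sim z x -> ~ sim z y -> ray2 x y A -> side A z false.
Proof. by move=> hx hy hz n1 n2 hA k; apply: ray2_avoid hA. Qed.

(** The powers of [z] leave every set near the two rays, and off such a set [A] agrees at [u] and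
    [u * h]. Taking [h = z] gives an eventual value, taking [h = k] carries it to the parallels. *)
Lemma side_exists x y z A : inford x -> inford y -> inford z ->
  ~ sim z x -> ~ sim z y -> supported (ray2 x y) (d0 A) -> exists v, side A z v.
Proof.
move=> hx hy hz n1 n2 hA.
have ai h := supported_translate h (ray2_ideal x y) hA.
have [N hN] := ray2_avoid 1 hx hy hz n1 n2 (ai z).
have cst n : N <= n -> A (z ^+ n) = A (z ^+ N).
  elim: n => [|n IH]; first by rewrite leqn0 => /eqP ->.
  rewrite leq_eqVlt => /orP[/eqP -> //|]; rewrite ltnS => le.
  rewrite -IH //; have := hN n le; rewrite mulg1 -expgSr => /addb_cancel.
  exact: esym.
exists (A (z ^+ N)) => k.
have [M hM] := ray2_avoid 1 hx hy hz n1 n2 (ai k).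
exists (maxn N M) => n; rewrite geq_max => /andP[l1 l2].
by have := hM n l2; rewrite mulg1 => /addb_cancel <-; apply: cst.
Qed.

Lemma side_near z C V : side C z false -> ray z V ->
  finsupp (fun y => V y && C y).
Proof.
move=> hC [Kl hK].
have : finsupp (fun y => `[< exists2 k, k \in Kl &
   C y /\ exists n, y = z ^+ n * k >]).
  apply: finsupp_ex => k _; have [N hN] := hC k.
  exists [seq z ^+ n * k | n <- iota 0 N] => y /asboolP[hCy [n e]].
  apply/mapP; exists n => //; rewrite mem_iota add0n ltnNge; apply/negP => /hN.
  by rewrite -e hCy.
apply: finsupp_sub => y /andP[/hK[n [k [hk e]]] hCy].
by apply/asboolP; exists k => //; split=> //; exists n.
Qed.

Lemma ray2_mask a b f C s : supported (ray2 a b) f -> side C b false ->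
  ray a (fun y => f (y, s) && (C y || C (y * gen_elt s))).
Proof.
move=> hf hC; have ra := ray_ideal a; have rb := ray_ideal b.
have [U1 [U2 [h1 h2 h]]] := hf s.
have f1 := side_near hC h2.
have f2 := side_near hC (ideal_tr rb (gen_elt s)^-1 h2).
have f3 : finsupp (fun y => U2 y && C (y * gen_elt s)).
  have := finsupp_inj (@mulIg _ (gen_elt s)) f2.
  by apply: finsupp_sub => y /=; rewrite mulgK.
apply: (ideal_sub ra) (ideal_or ra h1 (ideal_fin ra (finsuppU f1 f3))) => y.
by move=> /andP[/h/orP[->//|->]] /= ->; rewrite orbT.
Qed.

(** An edge cut by the intersection is cut by one set and has an end point in the other. As [B]
    avoids [b] and [A] avoids [c], only the ray [a] remains. *)
Lemma ray2_inter a b c A B :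
  supported (ray2 a b) (d0 A) -> supported (ray2 a c) (d0 B) ->
  side B b false -> side A c false ->
  supported (ray a) (d0 (fun y => A y && B y)).
Proof.
move=> hA hB sB sA s; have ra := ray_ideal a.
apply: (ideal_sub ra)
  (ideal_or ra (ray2_mask s hA sB) (ray2_mask s hB sA)) => y.
rewrite /d0 /=.
by case: (A y); case: (B y); case: (A _); case: (B _).
Qed.

Definition sep x y z w := exists A,
  [/\ supported (ray2 x y) (d0 A), side A z true & side A w false].

Lemma d0N A : d0 (fun y => ~~ A y) =1 d0 A.
Proof. by move=> e; rewrite /d0; xor. Qed.

Lemma supportedN I A : supported I (d0 A) -> supported I (d0 (fun y => ~~ A y)).
Proof. by apply: supported_ext => e; rewrite d0N. Qed.

Lemma supported_ray2C x y f : supported (ray2 x y) f -> supported (ray2 y x) f.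
Proof. by move=> h s; apply: ray2C. Qed.

Lemma sepC x y z w : sep x y z w -> sep y x z w.
Proof. by move=> [A [h1 h2 h3]]; exists A; split=> //; apply: supported_ray2C. Qed.

Lemma sepCr x y z w : sep x y z w -> sep x y w z.
Proof.
move=> [A [h1 h2 h3]]; exists (fun u => ~~ A u); split.
- exact: supportedN.
- exact: (sideN h3).
exact: (sideN h2).
Qed.

Lemma nontriv_sides x y z w A : inford x -> inford y -> inford z -> inford w ->
  ~ sim z x -> ~ sim z y -> ~ sim w x -> ~ sim w y ->
  supported (ray2 x y) (d0 A) -> side A z true -> side A w false -> nontriv x y A.
Proof.
move=> hx hy hz hw n1 n2 n3 n4 hA sz sw; split=> // h.
  by have := side_uniq sz (side_ray2 hx hy hz n1 n2 h).
by have := side_uniq (sideN sw) (side_ray2 hx hy hw n3 n4 h).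
Qed.

(** Merging two half-planes of the same pair at [x] leaves a set bounded near [y] alone, hence
    trivial. So they agree at the other ends up to complement, and any one of them decides
    separation. *)
Lemma sepP x y z w A v v' : inford x -> inford y -> inford z -> inford w ->
  ~ sim x y -> ~ sim z x -> ~ sim z y -> ~ sim w x -> ~ sim w y ->
  nontriv x y A -> side A z v -> side A w v' -> sep x y z w <-> v != v'.
Proof.
move=> hx hy hz hw nxy n1 n2 n3 n4 nA sz sw; split.
  move=> [B [hB tz fw]].
  have nB := nontriv_sides hx hy hz hw n1 n2 n3 n4 hB tz fw.
  have [F rF hF] := nontriv_merge hx hy hy nxy nxy nA nB.
  have hF' : supported (ray y) (d0 (fun u => A u (+) B u (+) F u)).
    move=> s; have [U1 [U2 [h1 h2 h]]] := hF s.
    by apply: (ideal_sub (ray_ideal y)) (ideal_or (ray_ideal y) h1 h2).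
  have s1 := sideD (sideD sz tz) (side_ray hx hz n1 rF).
  have s2 := sideD (sideD sw fw) (side_ray hx hw n3 rF).
  case: (ray_dichotomy hy hF') => r.
    have e1 := side_uniq s1 (side_ray hy hz n2 r).
    have e2 := side_uniq s2 (side_ray hy hw n4 r).
    by move: e1 e2; case: v {sz s1}; case: v' {sw s2}.
  have e1 := side_uniq (sideN s1) (side_ray hy hz n2 r).
  have e2 := side_uniq (sideN s2) (side_ray hy hw n4 r).
  by move: e1 e2; case: v {sz s1}; case: v' {sw s2}.
have [hA _ _] := nA.
case: v sz => sz; case: v' sw => sw // _; first by exists A.
by apply: sepCr; exists A.
Qed.

End Separation.

Lemma not_sim_sym (G : groupType) (x y : G) : ~ sim x y -> ~ sim y x.
Proof. by move=> h /sim_sym. Qed.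

(** * Separation of four distinct ends *)

Section SeparationAxioms.
Variable g : nat.
Notation P := (pi1 g).
Implicit Types (x y z a b c d : P) (A B C : P -> bool).

Section FourEnds.
Variables a b c d : P.
Hypotheses (ha : inford a) (hb : inford b) (hc : inford c) (hd : inford d).
Hypotheses (ab : ~ sim a b) (ac : ~ sim a c) (ad : ~ sim a d)
  (bc : ~ sim b c) (bd : ~ sim b d) (cd : ~ sim c d).

(* The complement of both half-planes is bounded by the ray [a] only, hence
   trivial. *)
Lemma sep_excl : sep a b c d -> sep a c b d -> False.
Proof.
move=> [A [hA Ac Ad]] [B [hB Bb Bd]].
have hE := ray2_inter (supportedN hA) (supportedN hB) (sideN Bb) (sideN Ac).
case: (ray_dichotomy ha hE) => r.
  have := side_uniq (sideI (sideN Ad) (sideN Bd))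
            (side_ray ha hd (not_sim_sym ad) r).
  by [].
have rA : ray a A.
  by apply: (ideal_sub (ray_ideal a)) r => y ->.
by have := side_uniq Ac (side_ray ha hc (not_sim_sym ac) rA).
Qed.

Lemma nontriv_side x y z : inford x -> inford y -> inford z ->
  ~ sim x y -> ~ sim z x -> ~ sim z y ->
  exists2 A, nontriv x y A & side A z false.
Proof.
move=> hx hy hz nxy n1 n2; have [A nA] := nontriv_exists hx hy nxy.
have [hA nt1 nt2] := nA.
have [[] sA] := side_exists hx hy hz n1 n2 hA; last by exists A.
exists (fun u => ~~ A u); last exact: (sideN sA).
split=> //; first exact: supportedN.
move=> h; apply: nt1; apply: (ideal_sub (ray2_ideal x y)) h => u.
by rewrite negbK.
Qed.

(** Half-planes for [a, b] and for [a, c] that miss [d] also miss [c] and [b] respectively, so they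
    meet only near [a]. Merged at [a] they give a set bounded by [b, c] that misses [d]; it remains
    to see that it contains the end [a]. *)
Lemma sep_other : ~ sep a b c d -> ~ sep a c b d -> sep b c a d.
Proof.
have ba := not_sim_sym ab; have ca := not_sim_sym ac; have da := not_sim_sym ad.
have cb := not_sim_sym bc; have db := not_sim_sym bd; have dc := not_sim_sym cd.
move=> n1 n2.
have [A nA Ad] := nontriv_side ha hb hd ab da db.
have [B nB Bd] := nontriv_side ha hc hd ac da dc.
have [hA _ _] := nA; have [hB _ _] := nB.
have Ac : side A c false.
  have [v sv] := side_exists ha hb hc ca cb hA.
  case: v sv => // sv; case: n1.
  by apply/(sepP ha hb hc hd ab ca cb da db nA sv Ad).
have Bb : side B b false.
  have [v sv] := side_exists ha hc hb ba bc hB.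
  case: v sv => // sv; case: n2.
  by apply/(sepP ha hc hb hd ac ba bc da dc nB sv Bd).
have rAB : ray a (fun y => A y && B y).
  case: (ray_dichotomy ha (ray2_inter hA hB Bb Ac)) => // r.
  by have := side_uniq (sideN (sideI Ad Bd)) (side_ray ha hd da r).
have [F rF hF] := nontriv_merge ha hb hc ab ac nA nB.
pose E y := A y (+) B y (+) F y.
have Ed : side E d false by exact: (sideD (sideD Ad Bd) (side_ray ha hd da rF)).
have [v Ea] := side_exists hb hc ha ab ac hF.
case: v Ea => Ea; first by exists E.
(* Now [E] misses the ray [a], so [A && E] is bounded by the ray [b] only. *)
have := ray2_inter (supported_ray2C hA) hF Ea Ac => /(ray_dichotomy hb)[] r.
  have [_ nt _] := nA; case: nt.
  have r1 := ray_ray2r a r; have r2 := ray_ray2l b rAB; have r3 := ray_ray2l b rF.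
  have iab := ray2_ideal a b.
  apply: (ideal_sub iab) (ideal_or iab (ideal_or iab r1 r2) r3) => y.
  by rewrite /E => ->; case: (B y); case: (F y).
have AEc : side (fun y => A y && E y) c false.
  by move=> k; have [N hN] := Ac k; exists N => n /hN ->.
by have := side_uniq (sideN AEc) (side_ray hb hc cb r).
Qed.

End FourEnds.
End SeparationAxioms.

(** * Totality and invariance of separation *)

Section SeparationInvariance.
Variable g : nat.
Notation P := (pi1 g).
Implicit Types (x y z a b c d : P) (A B C U : P -> bool).

(** If all three failed, [sep_other] would give both [sep b c a d] and [sep b d a c], which exclude
    each other. *)
Lemma sep_total a b c d : inford a -> inford b -> inford c -> inford d ->
  ~ sim a b -> ~ sim a c -> ~ sim a d -> ~ sim b c -> ~ sim b d -> ~ sim c d ->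
  [\/ sep a b c d, sep a c b d | sep a d b c].
Proof.
move=> ha hb hc hd ab ac ad bc bd cd.
have [|n1] := pselect (sep a b c d); first by constructor 1.
have [|n2] := pselect (sep a c b d); first by constructor 2.
have [|n3] := pselect (sep a d b c); first by constructor 3.
have s1 := sep_other ha hb hc hd ab ac ad bc bd cd n1 n2.
have n1' : ~ sep a b d c by move/sepCr.
have s2 := sep_other ha hb hd hc ab ad ac bd bc (not_sim_sym cd) n1' n3.
by have := sep_excl hb hd ha bd (not_sim_sym ab) (sepCr s1) (sepCr s2).
Qed.

Lemma sep_xor x y z w v : inford x -> inford y -> inford z -> inford w ->
  inford v -> ~ sim x y -> ~ sim z x -> ~ sim z y -> ~ sim w x -> ~ sim w y ->
  ~ sim v x -> ~ sim v y ->
  `[< sep x y z v >] = `[< sep x y z w >] (+) `[< sep x y w v >].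
Proof.
move=> hx hy hz hw hv nxy zx zy wx wy vx vy.
have [A nA] := nontriv_exists hx hy nxy; have [hA _ _] := nA.
have [i si] := side_exists hx hy hz zx zy hA.
have [j sj] := side_exists hx hy hw wx wy hA.
have [k sk] := side_exists hx hy hv vx vy hA.
rewrite (asbool_equiv_eq (sepP hx hy hz hv nxy zx zy vx vy nA si sk)).
rewrite (asbool_equiv_eq (sepP hx hy hz hw nxy zx zy wx wy nA si sj)).
rewrite (asbool_equiv_eq (sepP hx hy hw hv nxy wx wy vx vy nA sj sk)).
by rewrite !asboolb; case: i {si}; case: j {sj}; case: k {sk}.
Qed.

Lemma ray_sim x x' U : sim x x' -> ray x U -> ray x' U.
Proof.
move=> [p [q [hp hq e]]] [Kl hK].
exists [seq x ^+ r * k | r <- iota 0 p, k <- Kl] => y /hK[n [k [hk ->]]].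
exists (q * (n %/ p))%N, (x ^+ (n %% p) * k); split.
  by apply: allpairs_f => //; rewrite mem_iota add0n /= ltn_mod.
by rewrite expgnA -e -expgnA mulgA -expgnDr mulnC -divn_eq.
Qed.

Lemma ray2_sim x x' y y' U : sim x x' -> sim y y' -> ray2 x y U -> ray2 x' y' U.
Proof.
move=> sx sy [U1 [U2 [h1 h2 h]]]; exists U1, U2; split=> //.
  exact: ray_sim h1.
exact: ray_sim h2.
Qed.

Lemma side_sim z z' A v : sim z z' -> side A z v -> side A z' v.
Proof.
move=> [p [q [hp hq e]]] h k.
have [N hN] : exists N, forall r m, r < q -> N <= m ->
    A (z ^+ m * (z' ^+ r * k)) = v.
  elim: (q) => [|t [N hN]]; first by exists 0.
  have [M hM] := h (z' ^+ t * k); exists (maxn N M) => r m.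
  rewrite ltnS leq_eqVlt geq_max => /orP[/eqP -> /andP[_ /hM //]|].
  by move=> ? /andP[? _]; apply: hN.
exists (q * N)%N => n hn.
rewrite (divn_eq n q) mulnC expgnDr expgnA -e -expgnA -mulgA.
apply: hN; first by rewrite ltn_mod.
apply: leq_trans (leq_pmull _ hp).
by rewrite leq_divRL // mulnC.
Qed.

Lemma sep_sim x x' y y' z z' w w' : sim x x' -> sim y y' -> sim z z' ->
  sim w w' -> sep x y z w -> sep x' y' z' w'.
Proof.
move=> sx sy sz sw [A [h1 h2 h3]]; exists A; split.
- by move=> s; apply: ray2_sim (h1 s).
- exact: side_sim h2.
exact: side_sim h3.
Qed.

Section Automorphism.
Variables (phi psi : P -> P).
Hypotheses (phiM : {morph phi : x y / x * y}) (phiK : cancel phi psi)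
  (psiK : cancel psi phi).

Lemma aut1 : phi 1 = 1.
Proof. by apply: (mulgI (phi 1)); rewrite -phiM !mulg1. Qed.

Lemma autX x n : phi (x ^+ n) = phi x ^+ n.
Proof. by elim: n => [|n IH]; rewrite ?aut1 // !expgS phiM IH. Qed.

Lemma autV x : phi x^-1 = (phi x)^-1.
Proof. by apply/esym/mulg1_eq; rewrite -phiM mulgV aut1. Qed.

Lemma aut_inford x : inford x -> inford (phi x).
Proof.
move=> h n hn e; apply: (h n hn); apply: (can_inj phiK).
by rewrite autX e aut1.
Qed.

Lemma aut_sim x y : sim x y -> sim (phi x) (phi y).
Proof.
by move=> [p [q [hp hq e]]]; exists p, q; rewrite -!autX e.
Qed.

Lemma ray_aut x U : ray x U -> ray (phi x) (U \o psi).
Proof.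
move=> [Kl hK]; exists (map phi Kl) => y /hK[n [k [hk e]]].
by exists n, (phi k); rewrite map_f // -autX -phiM -e psiK.
Qed.

Lemma sep_aut x y z w : sep x y z w -> sep (phi x) (phi y) (phi z) (phi w).
Proof.
have psiM : {morph psi : u v / u * v}.
  by move=> u v; apply: (can_inj phiK); rewrite phiM !psiK.
have sideA A u v : side A u v -> side (A \o psi) (phi u) v.
  move=> h k; have [N hN] := h (psi k); exists N => n /hN.
  by rewrite /= psiM -autX phiK.
move=> [A [h1 h2 h3]]; exists (A \o psi); split; try exact: sideA.
(* The map [psi] need not send [gen_elt s] to a generator, so control of [A] under arbitrary right
   translations is used. *)
move=> s; have [U1 [U2 [r1 r2 h]]] :=
  supported_translate (psi (gen_elt s)) (ray2_ideal x y) h1.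
exists (U1 \o psi), (U2 \o psi); split; try exact: ray_aut.
by move=> u; rewrite /d0 /= psiM => /h.
Qed.

End Automorphism.
End SeparationInvariance.

(** * Finite cyclic orders *)

Record cyclic_separation (T : finType) (sp : T -> T -> T -> T -> bool) : Prop :=
  CyclicSeparation {
  csepC : forall x y z w, sp x y z w = sp y x z w;
  csepCr : forall x y z w, sp x y z w = sp x y w z;
  csep_xor : forall x y z w v, x != y ->
    z \notin [:: x; y] -> w \notin [:: x; y] -> v \notin [:: x; y] ->
    sp x y z v = sp x y z w (+) sp x y w v;
  csep_total : forall a b c d, uniq [:: a; b; c; d] ->
    [|| sp a b c d, sp a c b d | sp a d b c];
  csep_excl : forall a b c d, uniq [:: a; b; c; d] ->
    sp a b c d -> sp a c b d -> False;
  csep_three : exists a b c : T, [/\ a != b, a != c & b != c] }.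

Section CyclicOrder.
Variables (T : finType) (sp : T -> T -> T -> T -> bool).
Hypothesis H : cyclic_separation sp.
Let spC := csepC H.
Let spCr := csepCr H.
Let sp_xor := csep_xor H.
Let sp_total := csep_total H.
Let sp_excl := csep_excl H.

Lemma sp_irr x y z : x != y -> z \notin [:: x; y] -> sp x y z z = false.
Proof. by move=> h1 h2; rewrite (@sp_xor x y z z z) // addbb. Qed.

Lemma uniq4 (a b c d : T) : a != b -> a != c -> a != d -> b != c -> b != d ->
  c != d -> uniq [:: a; b; c; d].
Proof. by rewrite /= !inE !negb_or => -> -> -> -> -> ->. Qed.

Lemma uniq4P (a b c d : T) : uniq [:: a; b; c; d] ->
  [/\ a != b, a != c & a != d] /\ [/\ b != c, b != d & c != d].
Proof.
by rewrite /= !inE !negb_or => /and4P[/and3P[-> -> ->] /andP[-> ->] -> _].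
Qed.

(** The hypothesis excludes the other two pairings, so totality read from [c] leaves only this
    one. *)
Lemma sp_sym1 a b c d : uniq [:: a; b; c; d] -> sp a b c d -> sp c d a b.
Proof.
move=> u s; have [[ab ac ad] [bc bd cd]] := uniq4P u.
have h1 : sp a c b d = false by apply/negP => /(sp_excl u s).
have h2 : sp b c a d = false.
  by apply/negP => h; apply: (@sp_excl b a c d) h; rewrite 1?spC //;
    apply: uniq4; rewrite // eq_sym.
have /sp_total : uniq [:: c; a; b; d] by apply: uniq4; rewrite // eq_sym.
by rewrite (spC c a) h1 (spC c b) h2.
Qed.

Definition adj u v := (u != v) &&
  [forall z, forall w, (z \notin [:: u; v]) ==> (w \notin [:: u; v]) ==> ~~ sp u v z w].

Lemma adj_neq u v : adj u v -> u != v. Proof. by case/andP. Qed.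

Lemma adj_sp u v z w : adj u v -> uniq [:: u; v; z; w] -> sp u v z w = false.
Proof.
case/andP=> _ /forallP/(_ z)/forallP/(_ w) h /uniq4P[[_ uz uw] [vz vw _]].
apply/negbTE; move: h; rewrite !inE !negb_or.
by rewrite (eq_sym z u) (eq_sym z v) (eq_sym w u) (eq_sym w v) uz uw vz vw.
Qed.

Lemma adj_sym u v : adj u v = adj v u.
Proof.
have h a b : adj a b -> adj b a; last by apply/idP/idP; apply: h.
case/andP=> ab /forallP h; rewrite /adj eq_sym ab /=.
apply/forallP => z; have /forallP hz := h z; apply/forallP => w; have := hz w.
by rewrite !inE !negb_or (andbC (z != b)) (andbC (w != b)) (spC b).
Qed.

(** Choose [w] so that [x, w] cut off as few points of [C] from [p] as possible: a point still cut
    off would itself cut off strictly fewer. *)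
Lemma extreme x (C : {set T}) p q : x \notin C -> p \in C -> q \in C -> q != p ->
  exists w, [/\ w \in C, w != p &
    forall z, z \in C -> z != w -> z != p -> sp x w z p = false].
Proof.
move=> xC pC qC qp.
pose D w := [set z in C | [&& z != w, z != p & sp x w z p]].
have h0 : (q \in C) && (q != p) by rewrite qC.
case: (@arg_minnP _ q (fun w => (w \in C) && (w != p))
  (fun w => #|D w|) h0) => w /andP[wC wp] hmin.
exists w; split=> // z zC zw zp; apply/negbTE/negP => s.
have nx v : v \in C -> x != v by move=> vC; apply: contraNneq xC => ->.
suff : #|D z| < #|D w| by rewrite ltnNge hmin // zC.
apply: proper_card; apply/properP; split; last first.
  by exists z; rewrite !inE zC ?zw ?zp ?s ?eqxx ?andbF.
apply/subsetP => u; rewrite !inE => /and4P[uC uz up su].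
have xw := nx _ wC; have xz := nx _ zC; have xp := nx _ pC; have xu := nx _ uC.
have sw : sp x z w p = false.
  by apply/negP; apply: (@sp_excl x w z p) => //; apply: uniq4; rewrite // eq_sym.
have uw : u != w by apply/eqP => e; rewrite e sw in su.
rewrite uC uw up /=.
have e1 : sp x z u w.
  rewrite (@sp_xor x z u p w) ?inE ?negb_or //; rewrite ?(eq_sym _ x) ?xu ?xp ?xw //.
  - by rewrite su (spCr _ _ p) sw.
  - by rewrite eq_sym.
  - by rewrite eq_sym.
rewrite (@sp_xor x w u z p) ?inE ?negb_or //; rewrite ?(eq_sym _ x) ?xu ?xp ?xz //.
- rewrite s addbT; apply/negP => e2.
  apply: (@sp_excl x z w u); rewrite 1?spCr //.
  by apply: uniq4; rewrite // eq_sym.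
- by rewrite eq_sym.
Qed.

(** An extreme point among all points other than [w], seen from [w], has all the others on one
    side. *)
Lemma adj_other w p q : w != p -> w != q -> p != q ->
  exists2 u, adj w u & u != p.
Proof.
move=> wp wq pq.
have [||||u [uC up hu]] := @extreme w [set~ w] p q;
  rewrite ?inE ?eqxx // 1?eq_sym //.
rewrite !inE in uC; exists u => //.
rewrite /adj eq_sym uC /=; apply/forallP => y; apply/forallP => z.
rewrite !inE !negb_or; apply/implyP => /andP[yw yu].
apply/implyP => /andP[zw zu].
have wu : w != u by rewrite eq_sym.
have pw : p != w by rewrite eq_sym.
have pu : p != u by rewrite eq_sym.
have h t : t != w -> t != u -> sp w u t p = false.
  move=> tw tu; have [->|tp] := eqVneq t p; last by apply: hu; rewrite ?inE.
  by rewrite sp_irr // !inE negb_or pw.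
rewrite (@sp_xor w u y p z) ?inE ?negb_or ?yw ?zw ?pw //.
by rewrite h // (spCr _ _ p) h.
Qed.

(** Totality on these four points would make a neighbouring pair separate the other two. *)
Lemma adj_max2 w a b c : adj w a -> adj w b -> adj w c ->
  a != b -> a != c -> b != c -> False.
Proof.
move=> ha hb hc ab ac bc.
have na := adj_neq ha; have nb := adj_neq hb; have nc := adj_neq hc.
have := @sp_total w a b c; rewrite uniq4 // => /(_ isT).
rewrite (adj_sp ha) ?(adj_sp hb) ?(adj_sp hc) //; apply: uniq4 => //;
  by rewrite // eq_sym.
Qed.

Lemma adj_next w v : adj w v -> exists2 u, adj w u & u != v.
Proof.
move=> h; have wv := adj_neq h; have [a [b [c [ab ac bc]]]] := csep_three H.
have [q wq vq] : exists2 q, w != q & v != q.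
  case: (eqVneq w a) wv ab ac => [->|wa] wv ab ac.
    by case: (eqVneq v b) => [->|vb]; [exists c | exists b].
  case: (eqVneq v a) wv => [->|va] wv; last by exists a.
  by case: (eqVneq w b) => [->|wb]; [exists c | exists b].
exact: adj_other wv wq vq.
Qed.

(** For neighbours [w], [v] this is the unique other neighbour of [w], and the default does not
    occur. *)
Definition nb w v := odflt v [pick u | adj w u && (u != v)].

Lemma nbP w v : adj w v -> adj w (nb w v) && (nb w v != v).
Proof.
move=> h; rewrite /nb; case: pickP => [u //|no].
by have [u h1 h2] := adj_next h; have := no u; rewrite h1 h2.
Qed.

Lemma nb_uniq w v u : adj w v -> adj w u -> u != v -> u = nb w v.
Proof.
move=> h1 h2 n; have /andP[h3 n3] := nbP h1; apply/eqP/negPn/negP => n4.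
by apply: (adj_max2 h1 h2 h3) => //; rewrite eq_sym.
Qed.

Definition flag := {f : T * T | adj f.1 f.2}.

Lemma step_proof (f : flag) : adj (val f).2 (nb (val f).2 (val f).1).
Proof. by case: f => -[v w] /=; rewrite adj_sym => /nbP/andP[]. Qed.
Lemma flip_proof (f : flag) : adj (val f).2 (val f).1.
Proof. by case: f => -[v w] /=; rewrite adj_sym. Qed.

Definition step (f : flag) : flag := exist _ (_, _) (step_proof f).
Definition flip (f : flag) : flag := exist _ (_, _) (flip_proof f).

Lemma val_step f : val (step f) = ((val f).2, nb (val f).2 (val f).1).
Proof. by []. Qed.

Lemma val_flip f : val (flip f) = ((val f).2, (val f).1).
Proof. by []. Qed.

Lemma flipK : involutive flip.
Proof. by case=> -[v w] h; apply: val_inj. Qed.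

(** After turning around, the next point is the one just left. This dihedral relation also makes
    [step] injective. *)
Lemma step_flip_step f : step (flip (step f)) = flip f.
Proof.
case: f => -[v w] h; apply: val_inj => /=; congr (_, _); apply/esym.
rewrite /= adj_sym in h; have /andP[h1 h2] := nbP h.
by apply: nb_uniq => //; rewrite eq_sym.
Qed.

Lemma step_inj : injective step.
Proof.
move=> f f' e; apply: (inv_inj flipK).
by rewrite -(step_flip_step f) e step_flip_step.
Qed.

(** If [x] is not visited, let [w] be extreme among the visited points as seen from [x]. Both
    neighbours of [w] are visited, so [x, w] do not separate them; the other two pairings contain a
    neighbouring pair, against totality. *)
Lemma step_reach (f0 : flag) x : exists2 f, fconnect step f0 f & (val f).1 = x.
Proof.
pose C := [set v | [exists f : flag, fconnect step f0 f && ((val f).1 == v)]].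
suff : x \in C.
  by rewrite inE => /existsP[f /andP[h /eqP <-]]; exists f.
apply/negPn/negP => xC.
have inC f : fconnect step f0 f -> (val f).1 \in C /\ (val f).2 \in C.
  move=> h; rewrite !inE; split; apply/existsP; first by exists f; rewrite h eqxx.
  exists (step f); rewrite eqxx andbT.
  exact: connect_trans h (fconnect1 _ _).
have [pC qC] := inC f0 (connect0 _ _).
have pq : (val f0).2 != (val f0).1 by rewrite eq_sym; apply: adj_neq (valP f0).
have [w [wC wp hw]] := extreme xC pC qC pq.
have := wC; rewrite inE => /existsP[f /andP[hf /eqP ef]].
have hf' : fconnect step f0 (finv step f).
  exact: connect_trans hf (fconnect_finv _ _).
have fK := f_finv step_inj f.
move: (inC _ hf) (inC _ hf') (valP f) (valP (finv step f)).
have e1 : (val f).1 = (val (finv step f)).2 by rewrite -{1}fK.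
have e2 : (val f).2 = nb (val (finv step f)).2 (val (finv step f)).1.
  by rewrite -{1}fK.
set w1 := (val f).2 in e2 *; set w0 := (val (finv step f)).1 in e2 *.
rewrite -e1 ef in e2 *; move=> [_ w1C] [w0C _] a1 a0.
have w10 : w1 != w0 by rewrite adj_sym in a0; rewrite e2; case/andP: (nbP a0).
have nx v : v \in C -> x != v by move=> vC; apply: contraNneq xC => ->.
have xw := nx _ wC; have x0 := nx _ w0C; have x1 := nx _ w1C.
have n1 := adj_neq a1; have n0 := adj_neq a0.
have /sp_total : uniq [:: x; w; w0; w1] by apply: uniq4; rewrite // eq_sym.
have -> : sp x w0 w w1 = false.
  apply/negP => /sp_sym1 h; have := h (uniq4 x0 xw x1 n0 _ n1).
  rewrite (adj_sp a1) => [|]; last by apply: uniq4; rewrite // eq_sym.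
  by rewrite eq_sym => /(_ w10).
have -> : sp x w1 w w0 = false.
  apply/negP => /sp_sym1 h; have := h (uniq4 x1 xw x0 _ w10 _).
  rewrite adj_sym in a0; rewrite (adj_sp a0) => [|]; last first.
    by apply: uniq4; rewrite // eq_sym.
  by rewrite eq_sym n1 eq_sym n0 => /(_ isT isT).
rewrite !orbF.
have hp t : t \in C -> t != w -> sp x w t (val f0).1 = false.
  move=> tC tw; have [->|tp] := eqVneq t (val f0).1; last exact: hw.
  by rewrite sp_irr // !inE negb_or eq_sym nx // eq_sym.
rewrite (@sp_xor x w w0 (val f0).1 w1) //.
- by rewrite hp // spCr hp // eq_sym.
- by rewrite !inE negb_or eq_sym x0.
- by rewrite !inE negb_or eq_sym nx // eq_sym.
- by rewrite !inE negb_or eq_sym x1 eq_sym.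
Qed.

(** Some flag of the orbit starts at the same point as [f]. As a point has two neighbours, either it
    is [f] or [f] is the reverse of its predecessor. *)
Lemma flag_trans (f0 f : flag) :
  exists k, f = iter k step f0 \/ f = iter k step (flip f0).
Proof.
have flip_iter k h : iter k step (flip (iter k step h)) = flip h.
  elim: k h => // k IH h.
  by rewrite iterSr iterS step_flip_step IH.
have [f1 h1 e1] := step_reach f0 (val f).1.
have [E|n] := eqVneq (val f1).2 (val f).2.
  exists (findex step f0 f1); left; rewrite iter_findex //; apply: val_inj.
  by case: (val f) (val f1) e1 E => ? ? [? ?] /= -> ->.
have ef : f = flip (finv step f1).
  apply: val_inj => /=; have fK := f_finv step_inj f1.
  have e2 : (val (finv step f1)).2 = (val f).1 by rewrite -e1 -{2}fK.
  rewrite [LHS]surjective_pairing; congr (_, _) => //.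
  have e3 : (val f1).2 = nb (val f).1 (val (finv step f1)).1.
    by rewrite -e2 -{1}fK.
  have a0 := valP (finv step f1); rewrite /= adj_sym e2 in a0.
  apply/eqP/negPn/negP => n4; case/negP: n; apply/eqP/esym.
  by rewrite e3; apply: nb_uniq => //; exact: (valP f).
have h2 : fconnect step (finv step f1) f0.
  rewrite fconnect_sym; last exact: step_inj.
  exact: connect_trans h1 (fconnect_finv _ _).
exists (findex step (finv step f1) f0); right.
by rewrite -{2}(iter_findex h2) flip_iter.
Qed.

End CyclicOrder.

(** * Groups acting freely on flags *)

Section FlagAction.
Variables (g : nat) (S : (pi1 g -> pi1 g) -> Prop) (F : finType).
Variables (step flip : F -> F) (act : (pi1 g -> pi1 g) -> F -> F) (f0 : F).
Hypothesis subS : aut_subgroup S.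
Hypothesis flipK : involutive flip.
Hypothesis step_flip_step : forall f, step (flip (step f)) = flip f.
Hypothesis flag_trans : forall f,
  exists k, f = iter k step f0 \/ f = iter k step (flip f0).
Hypothesis act_id : act id =1 id.
Hypothesis act_comp : forall p q, S p -> S q ->
  forall f, act (p \o q) f = act p (act q f).
Hypothesis act_step : forall p, S p -> forall f, act p (step f) = step (act p f).
Hypothesis act_flip : forall p, S p -> forall f, act p (flip f) = flip (act p f).
Hypothesis act_free : forall p, S p -> act p f0 = f0 -> p = id.
Implicit Types p q r s : pi1 g -> pi1 g.

Local Definition Sid : S id := proj1 (proj2 subS).
Local Definition Scomp := proj1 (proj2 (proj2 subS)).
Local Definition Sinv := proj2 (proj2 (proj2 subS)).

Lemma S_inj p : S p -> injective p.
Proof. by move=> /(proj1 subS)[[q h _] _]; exact: can_inj h. Qed.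

Lemma flag_step_inj : injective step.
Proof.
move=> f f' e; apply: (inv_inj flipK).
by rewrite -(step_flip_step f) e step_flip_step.
Qed.

Lemma flip_iter k f : iter k step (flip (iter k step f)) = flip f.
Proof. by elim: k f => // k IH f; rewrite iterSr iterS step_flip_step IH. Qed.

Let m := order step f0.

Lemma m_gt0 : 0 < m. Proof. exact: order_gt0. Qed.

Lemma iter_m j : iter (j * m) step f0 = f0.
Proof.
elim: j => // j IH; rewrite mulSn iterD IH.
exact: (iter_order flag_step_inj).
Qed.

Lemma iter_m_flip j : iter (j * m) step (flip f0) = flip f0.
Proof. by rewrite -{1}(iter_m j) flip_iter. Qed.

Lemma fpowS r k : fpow r k.+1 = r \o fpow r k. Proof. by []. Qed.

Lemma fpowD r j k : fpow r (j + k) = fpow r j \o fpow r k.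
Proof. by elim: j => // j IH; rewrite addSn !fpowS IH. Qed.

Lemma S_fpow r k : S r -> S (fpow r k).
Proof.
move=> hr; elim: k => [|k IH]; first exact: Sid.
by rewrite fpowS; apply: Scomp.
Qed.

Lemma act_iter p k f : S p -> act p (iter k step f) = iter k step (act p f).
Proof. by move=> hp; elim: k => //= k IH; rewrite act_step // IH. Qed.

Lemma act_fpow r k0 k : S r -> act r f0 = iter k0 step f0 ->
  act (fpow r k) f0 = iter (k * k0) step f0.
Proof.
move=> hr e; elim: k => [|k IH]; first exact: act_id.
rewrite fpowS act_comp //; last exact: S_fpow.
by rewrite IH act_iter // e -iterD mulSn addnC.
Qed.

Definition rotation p := exists k, act p f0 = iter k step f0.

(** The rotation with the least positive displacement of [f0] generates: Euclidean division leaves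
    displacement 0, and freeness turns this into the identity. *)
Lemma rotation_gen : exists2 r, S r /\ rotation r &
  forall p, S p -> rotation p -> exists k, p = fpow r k.
Proof.
pose Q k := (0 < k) && `[< exists2 p, S p & act p f0 = iter k step f0 >].
have exQ : exists k, Q k.
  exists m; rewrite /Q m_gt0 /=; apply/asboolP; exists id; first exact: Sid.
  by rewrite act_id -[in RHS](mul1n m) iter_m.
case: (ex_minnP exQ) => k0 /andP[k0_gt0 /asboolP[r hr er]] mink0.
exists r; first by split=> //; exists k0.
move=> p hp [k ek]; exists (k %/ k0).
set q := fpow r _; have hq : S q by exact: S_fpow.
have eq : act q f0 = iter (k %/ k0 * k0) step f0 by exact: act_fpow.
have [q' hq' qK] := Sinv hq.
have e : act (q' \o p) f0 = iter (k %% k0) step f0.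
  rewrite act_comp // ek {1}(divn_eq k k0) addnC iterD act_iter // -eq.
  by rewrite -act_comp // qK act_id.
have e1 : q' \o p = id.
  apply: act_free; first exact: Scomp.
  rewrite e; case: (posnP (k %% k0)) => [->//|pos].
  have := mink0 (k %% k0); rewrite leqNgt ltn_mod k0_gt0 => h.
  suff : false by []. apply: h; rewrite /Q pos; apply/asboolP.
  by exists (q' \o p) => //; exact: Scomp.
apply: funext => x; apply: (S_inj hq').
by rewrite -[LHS]/((q' \o p) x) -[RHS]/((q' \o q) x) e1 qK.
Qed.

Lemma reflection_flip p : S p -> ~ rotation p ->
  exists k, act p f0 = iter k step (flip f0).
Proof.
move=> hp nr; have [k [e|e]] := flag_trans (act p f0); last by exists k.
by case: nr; exists k.
Qed.

Lemma reflection_comp p s : S p -> S s -> ~ rotation p -> ~ rotation s ->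
  rotation (p \o s).
Proof.
move=> hp hs np ns.
have [j ej] := reflection_flip hp np; have [k ek] := reflection_flip hs ns.
(* A multiple of the orbit length [m] makes the exponent at least [j], so that the truncated
   subtraction below is exact. *)
have {}ek : act s f0 = iter (k + j * m) step (flip f0).
  by rewrite iterD iter_m_flip.
rewrite /rotation act_comp // ek act_iter // act_flip // ej.
have le : j <= k + j * m.
  by apply: leq_trans (leq_addl _ _); apply: leq_pmulr; exact: m_gt0.
by rewrite -(subnK le) iterD flip_iter flipK; exists (k + j * m - j).
Qed.

Lemma reflection_invol s : S s -> ~ rotation s -> s \o s = id.
Proof.
move=> hs ns; have [k ek] := reflection_flip hs ns.
apply: act_free; first exact: Scomp.
by rewrite act_comp // {1}ek act_iter // act_flip // ek flip_iter flipK.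
Qed.

Lemma cyclic_or_dihedral : cyclic_sg S \/ dihedral_sg S.
Proof.
have [r [hr [k0 ek0]] gen] := rotation_gen.
have rotX k : rotation (fpow r k).
  by exists (k * k0)%N; apply: act_fpow.
have [allrot|] := pselect (forall p, S p -> rotation p).
  by left; exists r => // p hp; apply: gen => //; apply: allrot.
move=> /existsNP[s /not_implyP[hs ns]].
have exn : exists n, (0 < n) && `[< fpow r n = id >].
  exists m; rewrite m_gt0; apply/asboolP; apply: act_free; first exact: S_fpow.
  by rewrite (act_fpow _ hr ek0) mulnC iter_m.
case: (ex_minnP exn) => n /andP[n_gt0 /asboolP rn] minn.
have ss := reflection_invol hs ns.
have cases p : S p -> exists k, p = fpow r k \/ p = fpow r k \o s.
  move=> hp; have [rp|np] := pselect (rotation p).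
    by have [k ->] := gen _ hp rp; exists k; left.
  have [k ek] := gen _ (Scomp hp hs) (reflection_comp hp hs np ns).
  by exists k; right; rewrite -ek -[RHS]/(p \o (s \o s)) ss.
have rr : r \o fpow r n.-1 = id by rewrite -fpowS prednK.
(* Without nontrivial rotations the group consists of the identity and [s], and counts as cyclic. *)
have [n1|n_neq1] := eqVneq n 1%N.
  left; exists s => // p /cases[k].
  have -> : fpow r k = id.
    elim: k => // k IH; rewrite fpowS IH.
    by have := rn; rewrite n1.
  by case=> ->; [exists 0 | exists 1%N].
right; exists n, r, s; split; split=> //.
- by case: n n_gt0 n_neq1 {rn minn rr} => [|[]].
- move=> k /andP[k_gt0 ltkn] e; have := minn k; rewrite k_gt0 e leqNgt ltkn.
  by move=> h; suff : false by []; apply: h; apply/asboolP.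
(* The composite is a reflection too, hence an involution; this is the dihedral relation. *)
- have nsr : ~ rotation (s \o r).
    move=> h; have [k ek] := gen _ (Scomp hs hr) h; apply: ns.
    rewrite (_ : s = fpow r (k + n.-1)); first exact: rotX.
    by rewrite fpowD -ek -[RHS]/(s \o (r \o fpow r n.-1)) rr.
  have e := reflection_invol (Scomp hs hr) nsr.
  rewrite -[LHS]/(((s \o r) \o s) \o id) -rr.
  by rewrite -[LHS]/(((s \o r) \o (s \o r)) \o fpow r n.-1) e.
- by move=> k e; apply: ns; rewrite e; apply: rotX.
move=> p; split; first exact: cases.
by case=> k [->|->]; [|apply: Scomp => //]; apply: S_fpow.
Qed.

End FlagAction.

(** * Free-by-cyclic normal forms *)

Section FreeWords.
Variable X : eqType.
Implicit Types (l : X * bool) (u v w : seq (X * bool)).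

Definition finv_letter l := (l.1, ~~ l.2).
Definition finv_word w := rev (map finv_letter w).

(* Words are stored with their last letter first, so that [push] is right
   multiplication by a letter. *)
Definition push l w :=
  if w is l' :: w' then if l' == finv_letter l then w' else l :: w else [:: l].

Definition reduced w := sorted (fun l l' => l' != finv_letter l) w.

Definition ract w u := foldl (fun w l => push l w) w u.

Lemma finv_letterK : involutive finv_letter.
Proof. by case=> x e; rewrite /finv_letter /= negbK. Qed.

Lemma push_reduced l w : reduced w -> reduced (push l w).
Proof.
case: w => [//|l' w] /= h; case: eqP => [_|/eqP n] /=; last by rewrite n.
by case: w h => //= l2 w /andP[].
Qed.

Lemma push_inv l w : reduced w -> push (finv_letter l) (push l w) = w.
Proof.
case: w => [_|l' w] /=; first by rewrite finv_letterK eqxx.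
case: eqP => [->|_ _] /=; last by rewrite finv_letterK eqxx.
case: w => [//|l2 w] /= /andP[n _].
by rewrite finv_letterK in n *; rewrite (negbTE n).
Qed.

Lemma ract_cat w u v : ract w (u ++ v) = ract (ract w u) v.
Proof. exact: foldl_cat. Qed.

Lemma ract_reduced w u : reduced w -> reduced (ract w u).
Proof. by elim: u w => //= l u IH w h; apply/IH/push_reduced. Qed.

Lemma ract_inv w u : reduced w -> ract w (u ++ finv_word u) = w.
Proof.
elim: u w => //= l u IH w h.
rewrite /finv_word map_cons rev_cons -cats1 catA ract_cat /=.
by rewrite IH ?push_inv //; apply: push_reduced.
Qed.

Lemma finv_wordK : involutive finv_word.
Proof.
move=> w; rewrite /finv_word map_rev revK -map_comp -[RHS]map_id.
by apply: eq_map => x /=; rewrite finv_letterK.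
Qed.

Lemma ract_inv' w u : reduced w -> ract w (finv_word u ++ u) = w.
Proof. by move=> h; rewrite -{2}[u]finv_wordK ract_inv. Qed.

Definition sgn_letter l : int := (if l.2 then -1 else 1)%R.
Definition fexp w : int := foldr (fun l s => (sgn_letter l + s)%R) 0%R w.

Lemma fexp_push l w : fexp (push l w) = (sgn_letter l + fexp w)%R.
Proof.
case: w => [//|l' w] /=; case: eqP => [->|//] /=.
by rewrite /sgn_letter /=; case: l => x [] /=; lia.
Qed.

Lemma fexp_foldr v w : fexp (foldr push v w) = (fexp w + fexp v)%R.
Proof. by elim: w => /= [|l w IH]; rewrite ?fexp_push ?IH /=; lia. Qed.

Variable c : X.
Definition is_c l := l.1 == c.

Lemma push_is_c d w : ~~ is_c d -> all is_c w -> push d w = d :: w.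
Proof.
case: w => //= l w nd /andP[cl _]; case: eqP => // e.
by case/negP: nd; move: cl; rewrite e.
Qed.

Lemma all_is_c_push l w : is_c l -> all is_c w -> all is_c (push l w).
Proof.
case: w => /= [->//|l' w cl /andP[cl' cw]].
by case: eqP => _ //=; rewrite cl cl'.
Qed.

Lemma foldr_push_reduced u d v : reduced (rcons u d) ->
  foldr push (d :: v) u = u ++ d :: v.
Proof.
elim: u => //= l u IH h.
have h' : reduced (rcons u d).
  by case: u h {IH} => //= a u /andP[].
rewrite IH //; case: u h {IH h'} => /= [|a u] /andP[/negbTE n _]; by rewrite n.
Qed.

Lemma suffix_is_c u u' d s s' : ~~ is_c d -> all is_c s -> all is_c s' ->
  u ++ d :: s = u' ++ d :: s' -> s = s'.
Proof.
move=> nd hs hs' e.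
have hf t v : all is_c t -> find (predC is_c) (rev (v ++ d :: t)) = size t.
  move=> ht; rewrite rev_cat rev_cons find_cat has_rcons /= nd /=.
  rewrite -cats1 find_cat has_rev /= nd size_rev addn0.
  case: ifP => // /hasP[a ha]; rewrite /= (allP ht a) //.
have sz : size s = size s' by rewrite -(hf s u hs) e hf.
have := congr1 rev e; rewrite !rev_cat !rev_cons => /eqP.
rewrite eqseq_cat ?size_rcons ?size_rev ?sz // => /andP[/eqP/rcons_inj[+] _].
exact: (can_inj (@revK _)).
Qed.

(** The hypothesis says that [w] commutes with c^p. Otherwise let [d] be the first letter of the
    word other than [c] or its inverse, and [s] the block before it, stored as a tail. Right
    multiplication keeps [s], while left multiplication raises its exponent by [p]. *)
Lemma free_commute p w : 0 < p -> reduced w ->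
  iter p (push (c, false)) w = foldr push (nseq p (c, false)) w -> all is_c w.
Proof.
move=> p_gt0 rw e; apply/negPn/negP => nall.
have [u [d [s [ew nd hs]]]] : exists u d s,
    [/\ w = u ++ d :: s, ~~ is_c d & all is_c s].
  elim: w nall {rw e} => //= l w IH; rewrite negb_and.
  have [hw nl|/IH[u [d [s [-> nd hs]]]] _] := boolP (all is_c w).
    by exists [::], l, w; rewrite orbF in nl.
  by exists (l :: u), d, s.
have cc : is_c (c, false) by rewrite /is_c.
have hX : all is_c (foldr push (nseq p (c, false)) s).
  elim: (s) hs => /= [_|l t IH /andP[hl ht]]; last by apply: all_is_c_push; auto.
  by rewrite all_nseq cc orbT.
have e2 : foldr push (nseq p (c, false)) w
        = u ++ d :: foldr push (nseq p (c, false)) s.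
  rewrite ew foldr_cat /= push_is_c // foldr_push_reduced //.
  by move: rw; rewrite ew -cat_rcons /reduced => /cat_sorted2[].
have [u' e1] : exists u', iter p (push (c, false)) w = u' ++ d :: s.
  elim: (p) => [|q [u' IH]]; first by exists u.
  rewrite iterS IH; case: u' {IH} => [|l u'] /=.
    case: eqP => [ed|_]; last by exists [:: (c, false)].
    by case/negP: nd; rewrite ed.
  by case: eqP => _; [exists u' | exists [:: (c, false), l & u']].
have es := suffix_is_c nd hs hX (etrans (esym e1) (etrans e e2)).
have := fexp_foldr (nseq p (c, false)) s; rewrite -es.
have -> : fexp (nseq p (c, false)) = Posz p.
  by elim: (p) => //= q ->; rewrite /sgn_letter /=; lia.
by move: p_gt0; lia.
Qed.

End FreeWords.

(** * The action of the surface group on normal forms *)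

Section FreeByCyclic.
Variable n : nat.
Notation g := n.+1.
Notation P := (pi1 g).
Notation X := ('I_g * bool * int)%type.
Notation state := (seq (X * bool) * int)%type.
Implicit Types (w : seq (X * bool)) (k : int) (st : state) (x y t : P).

Definition rest : seq 'I_g := map (lift ord0) (enum 'I_n).
Definition bX : X := (ord0, true, 0%R).

Lemma relator_rest :
  relator g = comm_word ord0 ++ flatten (map (@comm_word g) rest).
Proof. by rewrite /relator enum_ordSl. Qed.

Lemma rest_neq0 i : i \in rest -> i != ord0.
Proof. by case/mapP=> j _ ->; rewrite eq_sym neq_lift. Qed.

(* The conjugates by [a_0 ^ k] of the commutator word of handle [i], of the
   product of all commutators but the first, and of [b_0], as words in the
   letters [(s, k) = a_0 ^ k * s * a_0 ^ - k], [s] not in handle 0, and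
   [bX = b_0]: the relator turns [a_0 * b_0 * a_0 ^-1] into
   [C ^-1 * b_0]. *)
Definition comm_letters k (i : 'I_g) : seq (X * bool) :=
  [:: ((i, false, k), false); ((i, true, k), false);
      ((i, false, k), true); ((i, true, k), true)].
Definition C_letters k := flatten (map (comm_letters k) rest).
Fixpoint b_letters_pos (m : nat) :=
  if m is m'.+1 then finv_word (C_letters (Posz m')) ++ b_letters_pos m'
  else [:: (bX, false)].
Fixpoint b_letters_neg (m : nat) :=
  C_letters (Negz m) ++ (if m is m'.+1 then b_letters_neg m' else [:: (bX, false)]).
Definition b_letters k :=
  match k with Posz m => b_letters_pos m | Negz m => b_letters_neg m end.

Lemma ract_b_lettersS w k : reduced w ->
  ract w (b_letters (k + 1)%R) = ract w (finv_word (C_letters k) ++ b_letters k).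
Proof.
move=> rw; case: k => [m|[|m]].
- by have -> : (Posz m + 1)%R = Posz m.+1 by lia.
- have -> : (Negz 0 + 1)%R = Posz 0 by lia.
  by rewrite /= catA ract_cat ract_inv'.
have -> : (Negz m.+1 + 1)%R = Negz m by lia.
by rewrite /= catA ract_cat ract_inv'.
Qed.

(** Right multiplication on the normal form w * a_0^k, with w in the free kernel: a letter other
    than a_0 enters w conjugated by a_0^k. *)
Definition lact st (l : letter g) : state :=
  let: (i, e, ng) := l in
  if i == ord0 then
    if e then
      (ract st.1 (if ng then finv_word (b_letters st.2) else b_letters st.2),
       st.2)
    else (st.1, st.2 + (if ng then -1 else 1))%R
  else (push ((i, e, st.2), ng) st.1, st.2).

Definition wact st (u : word g) : state := foldl lact st u.

Lemma lact_reduced st l : reduced st.1 -> reduced (lact st l).1.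
Proof.
case: l => -[i e] ng h; rewrite /lact; case: (i == ord0); last exact: push_reduced.
by case: e => //=; apply: ract_reduced.
Qed.

Lemma wact_reduced st u : reduced st.1 -> reduced (wact st u).1.
Proof. by elim: u st => //= l u IH st h; apply/IH/lact_reduced. Qed.

Lemma wact_cat st u v : wact st (u ++ v) = wact (wact st u) v.
Proof. exact: foldl_cat. Qed.

Lemma wact_cons st l u : wact st (l :: u) = wact (lact st l) u.
Proof. by []. Qed.

Lemma lact_linv st l : reduced st.1 -> lact (lact st l) (linv l) = st.
Proof.
case: st => w k /= h; case: l => -[i e] ng; rewrite /lact /linv /=.
case: eqP => [_|ne] /=.
  case: e => /=; congr (_, _).
    case: ng => /=; first by rewrite -ract_cat ract_inv'.
    by rewrite -ract_cat ract_inv.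
  by case: ng => /=; lia.
by congr (_, _); rewrite (@push_inv _ ((i, e, k), ng)).
Qed.

Lemma wact_rest w k : wact (w, k) (flatten (map (@comm_word g) rest))
  = (ract w (C_letters k), k).
Proof.
rewrite /C_letters; have : all (fun i => i != ord0) rest.
  by apply/allP => i /rest_neq0.
elim: rest w => //= i r IH w /andP[/negbTE ni hr].
by rewrite !ni /= IH.
Qed.

(** The first commutator multiplies by [b_letters (k + 1)] and the inverse of [b_letters k], which
    amounts to the inverse of [C_letters k]; the other handles multiply by [C_letters k]. *)
Lemma wact_relator st : reduced st.1 -> wact st (relator g) = st.
Proof.
case: st => w k /= h; rewrite relator_rest wact_cat /= /lact /=.
have e : (k + 1 - 1)%R = k by lia.
rewrite [(k + 1 + -1)%R]e wact_rest; congr (_, _).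
rewrite ract_b_lettersS // ract_cat -[ract (ract _ (b_letters k)) _]ract_cat ract_inv.
  by rewrite -ract_cat ract_inv'.
exact: ract_reduced.
Qed.

Lemma wact_surf_rel u v st : surf_rel u v -> reduced st.1 ->
  wact st u = wact st v.
Proof.
move=> h; elim: h st => {u v} [u v s|//|u v _ IH|u v w _ IH1 _ IH2] st r.
- case: s => [a b l|a b]; rewrite !wact_cat.
    by rewrite !wact_cons lact_linv //; apply: wact_reduced.
  by rewrite wact_relator //; apply: wact_reduced.
- by rewrite IH.
by rewrite IH1 // IH2.
Qed.

Definition gact st x : state := wact st (rep x).

Lemma gact_reduced st x : reduced st.1 -> reduced (gact st x).1.
Proof. exact: wact_reduced. Qed.

Lemma gact_cls st u : reduced st.1 -> gact st (cls u) = wact st u.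
Proof. exact: wact_surf_rel (rep_cls u). Qed.

Lemma gactM st x y : reduced st.1 -> gact st (x * y) = gact (gact st x) y.
Proof.
move=> h; rewrite -[x]repK -[y]repK -cls_cat !gact_cls ?wact_cat //.
exact: wact_reduced.
Qed.

Lemma gactV st st' x : reduced st.1 -> gact st x = st' -> gact st' x^-1 = st.
Proof. by move=> h <-; rewrite -gactM // mulgV -cls_nil gact_cls. Qed.

Definition zp k : P :=
  match k with
  | Posz m => (@gen_a g ord0) ^+ m
  | Negz m => ((@gen_a g ord0) ^+ m.+1)^-1
  end.

Lemma zp_succ k : zp (k + 1)%R = zp k * @gen_a g ord0.
Proof.
case: k => [m|[|m]].
- have -> : (Posz m + 1)%R = Posz m.+1 by lia.
  by rewrite /zp expgSr.
- have -> : (Negz 0 + 1)%R = Posz 0 by lia.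
  by rewrite /zp expg0 expg1 mulVg.
have -> : (Negz m.+1 + 1)%R = Negz m by lia.
by rewrite /zp [in RHS]expgS invgM mulgVK.
Qed.

Lemma zp_pred k : zp (k - 1)%R = zp k * (@gen_a g ord0)^-1.
Proof. by rewrite -{2}[k](GRing.subrK 1%R) zp_succ mulgK. Qed.

Lemma gact_zp w k j : reduced w -> gact (w, k) (zp j) = (w, k + j)%R.
Proof.
move=> rw.
have h1 k' : gact (w, k') (@gen_a g ord0) = (w, k' + 1)%R.
  by rewrite /gen_a /gen_elt gact_cls.
have hX m k' : gact (w, k') ((@gen_a g ord0) ^+ m) = (w, k' + Posz m)%R.
  elim: m k' => [|m IH] k'.
    by rewrite expg0 -cls_nil gact_cls //=; congr (_, _); lia.
  by rewrite expgSr gactM // IH h1; congr (_, _); lia.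
case: j => m; first exact: hX.
by apply: gactV => //; rewrite hX; congr (_, _); lia.
Qed.

Definition evl (l : X * bool) : P :=
  zp l.1.2 * (if l.2 then (gen_elt l.1.1)^-1 else gen_elt l.1.1) * (zp l.1.2)^-1.
(** For words stored last letter first, as in states; [evp] serves words in reading order, such as
    [b_letters k]. *)
Definition evw w : P := foldr (fun l acc => acc * evl l) 1 w.
Definition evp w : P := foldr (fun l acc => evl l * acc) 1 w.

Lemma evl_inv l : evl (finv_letter l) = (evl l)^-1.
Proof. by case: l => a [] /=; rewrite /evl /=; gsimp. Qed.

Lemma evp_cat w w' : evp (w ++ w') = evp w * evp w'.
Proof. by elim: w => /= [|l w IH]; rewrite ?mul1g // IH mulgA. Qed.

Lemma evp_inv w : evp (finv_word w) = (evp w)^-1.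
Proof.
elim: w => [|l w IH]; first by rewrite invg1.
have e : evp [:: finv_letter l] = (evl l)^-1 by rewrite -evl_inv -[RHS]mulg1.
rewrite /finv_word map_cons rev_cons -cats1 evp_cat -/(finv_word w) IH e.
by rewrite -invgM.
Qed.

Lemma evw_push l w : evw (push l w) = evw w * evl l.
Proof.
case: w => [//|l' w]; rewrite /push; case: eqP => [->|//].
by rewrite /= -/(finv_letter l) evl_inv mulgVK.
Qed.

Lemma evw_ract w u : evw (ract w u) = evw w * evp u.
Proof.
elim: u w => /= [|l u IH] w; first by rewrite mulg1.
by rewrite IH evw_push -mulgA.
Qed.

Definition Crest : P := cls (flatten (map (@comm_word g) rest)).

Lemma evp_C_letters k : evp (C_letters k) = zp k * Crest * (zp k)^-1.
Proof.
rewrite /C_letters /Crest; elim: rest => /= [|i r IH].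
  by rewrite cls_nil mulg1 mulgV.
rewrite IH /evl /=.
rewrite -[_ :: _]/(comm_word i ++ flatten (map (@comm_word g) r)) cls_cat cls_comm.
by rewrite /comm_elt /gen_a /gen_b; gsimp.
Qed.

Lemma conj_b_by_a :
  @gen_a g ord0 * @gen_b g ord0 * (@gen_a g ord0)^-1 = Crest^-1 * @gen_b g ord0.
Proof.
have := cls_relator g; rewrite relator_rest cls_cat cls_comm -/Crest /comm_elt.
move/eqP; rewrite mulg_eq1 => /eqP e.
by rewrite -e mulgVK.
Qed.

Lemma evp_b_letters k : evp (b_letters k) = zp k * @gen_b g ord0 * (zp k)^-1.
Proof.
have b0 : evp [:: (bX, false)] = @gen_b g ord0.
  by rewrite /= /evl /= /zp expg0; gsimp.
have stp k' : zp (k' + 1)%R * @gen_b g ord0 * (zp (k' + 1)%R)^-1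
   = (evp (C_letters k'))^-1 * (zp k' * @gen_b g ord0 * (zp k')^-1).
  rewrite zp_succ evp_C_letters invgM !mulgA.
  rewrite -(mulgA (zp k')) -(mulgA (zp k')) conj_b_by_a; gsimp.
  by [].
have zp0 : zp 0%R = 1 by [].
case: k => m; elim: m => [|m IH].
- by rewrite [LHS]b0 [Posz 0](_ : _ = 0%R) // zp0; gsimp.
- have -> : b_letters (Posz m.+1)
    = finv_word (C_letters (Posz m)) ++ b_letters (Posz m) by [].
  have -> : Posz m.+1 = (Posz m + 1)%R by lia.
  by rewrite stp evp_cat evp_inv IH.
- have -> : b_letters (Negz 0) = C_letters (Negz 0) ++ [:: (bX, false)] by [].
  have := stp (Negz 0); rewrite [(Negz 0 + 1)%R](_ : _ = 0%R) //.
  by rewrite evp_cat b0 zp0 invg1 mulg1 mul1g => e; rewrite {1}e mulVKg.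
have -> : b_letters (Negz m.+1) = C_letters (Negz m.+1) ++ b_letters (Negz m) by [].
have := stp (Negz m.+1).
rewrite [(Negz m.+1 + 1)%R](_ : _ = Negz m); last by lia.
by rewrite evp_cat IH => ->; rewrite mulVKg.
Qed.

Definition ev st : P := evw st.1 * zp st.2.

Lemma ev_lact st l : ev (lact st l) = ev st * cls [:: l].
Proof.
case: st => w k; case: l => -[i e] ng; rewrite /lact /ev cls_letter /=.
case: eqP => [->|ne] /=; last by rewrite evw_push /evl /=; gsimp; case: ng.
case: e => /=.
  rewrite evw_ract; case: ng; rewrite ?evp_inv evp_b_letters /gen_b; gsimp => //.
by case: ng; rewrite ?zp_pred ?zp_succ mulgA.
Qed.

Lemma ev_wact st u : ev (wact st u) = ev st * cls u.
Proof.
elim: u st => [|l u IH] st /=; first by rewrite cls_nil mulg1.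
by rewrite IH ev_lact -mulgA -cls_cons.
Qed.

Definition nf x : state := gact ([::], 0%R) x.

Lemma ev_nf x : ev (nf x) = x.
Proof.
rewrite /nf /gact ev_wact repK /ev /zp /= expg0.
by rewrite !mul1g.
Qed.

(** The letters of the free basis: of those that [X] has for handle 0, only [bX] is kept. *)
Definition valid (l : X * bool) := (l.1.1.1 != ord0) || (l.1 == bX).

Lemma valid_push l w : valid l -> all valid w -> all valid (push l w).
Proof.
case: w => /= [->//|l' w vl /andP[vl' vw]].
by case: eqP => _ //=; rewrite vl vl'.
Qed.

Lemma valid_ract w u : all valid w -> all valid u -> all valid (ract w u).
Proof.
by elim: u w => //= l u IH w h /andP[vl vu]; apply: IH => //; apply: valid_push.
Qed.

Lemma valid_inv w : all valid w -> all valid (finv_word w).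
Proof. by move=> h; rewrite /finv_word all_rev all_map. Qed.

Lemma valid_C_letters k : all valid (C_letters k).
Proof.
rewrite /C_letters; have : all (fun i => i != ord0) rest.
  by apply/allP => i /rest_neq0.
elim: rest => //= i r IH /andP[h1 h2].
by rewrite /valid /= h1 /= IH.
Qed.

Lemma valid_b_letters k : all valid (b_letters k).
Proof.
have vb : valid (bX, false) by rewrite /valid eqxx orbT.
case: k => m; elim: m => [|m IH] /=; rewrite ?all_cat ?valid_C_letters /= ?vb //.
by rewrite valid_inv ?valid_C_letters.
Qed.

Lemma valid_wact st u : all valid st.1 -> all valid (wact st u).1.
Proof.
elim: u st => //= l u IH [w k] h; apply: IH; case: l => -[i e] ng.
rewrite /lact; case: eqP => [_|/eqP ne] /=; last first.
  by apply: valid_push => //; rewrite /valid /= ne.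
case: e => //=; apply: valid_ract => //.
by case: ng; rewrite ?valid_inv ?valid_b_letters.
Qed.

Lemma gact_evl v l : reduced v -> valid l -> gact (v, 0%R) (evl l) = (push l v, 0%R).
Proof.
move=> rv; case: l => -[[i e] k] ng vl; rewrite /evl /=.
have r' := push_reduced (((i, e), k), ng) rv.
have hs : gact (v, k) (if ng then (gen_elt (i, e))^-1 else gen_elt (i, e))
        = (push ((i, e, k), ng) v, k).
  have -> : (if ng then (gen_elt (i, e))^-1 else gen_elt (i, e))
    = cls [:: ((i, e), ng)].
    by rewrite cls_letter.
  rewrite gact_cls //= /lact; case: eqP vl => [->|//]; rewrite /valid /= ?eqxx /=.
  by move=> /eqP[-> ->]; case: ng {r'}.
rewrite !gactM ?gact_zp ?GRing.add0r ?hs //.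
by apply: gactV => //; rewrite gact_zp // GRing.add0r.
Qed.

Lemma gact_evw v w : reduced v -> all valid w ->
  gact (v, 0%R) (evw w) = (foldr (@push X) v w, 0%R).
Proof.
move=> rv; elim: w => [_|l w IH /= /andP[vl vw]].
  by rewrite /= -cls_nil gact_cls.
rewrite gactM // IH // gact_evl //.
by have := gact_reduced (evw w) (st := (v, 0%R)) rv; rewrite IH.
Qed.

Lemma gact_pow v l p : reduced v -> valid l ->
  gact (v, 0%R) (evl l ^+ p) = (iter p (push l) v, 0%R).
Proof.
move=> rv vl; elim: p => [|p IH]; first by rewrite expg0 -cls_nil gact_cls.
rewrite expgSr gactM // IH gact_evl //.
by elim: p {IH} => // p IH; apply: push_reduced.
Qed.

(** Applying both products to the empty state turns the commutation into the equation of reduced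
    words in [free_commute]. *)
Lemma commute_letter t (c : X) p : (nf t).2 = 0%R -> valid (c, false) -> 0 < p ->
  commute t (evl (c, false) ^+ p) -> all (fun l : X * bool => l.1 == c) (nf t).1.
Proof.
move=> t0 vc p_gt0 com; set w := (nf t).1.
have ew : nf t = (w, 0%R) by rewrite [LHS]surjective_pairing t0.
have rw : reduced w by exact: gact_reduced.
have vw : all valid w by exact: valid_wact.
have et : t = evw w by rewrite -[t]ev_nf ew /ev /= /zp expg0 mulg1.
apply: (free_commute p_gt0 rw).
have : gact ([::], 0%R) (t * evl (c, false) ^+ p)
     = gact ([::], 0%R) (evl (c, false) ^+ p * t) by rewrite com.
rewrite !gactM // -/(nf t) ew !gact_pow // {1}et gact_evw //; last first.
  by elim: (p) => // q IH; apply: push_reduced.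
case=> ->; congr (foldr _ _ _); clear; elim: p => // p IH.
by rewrite iterS IH; case: p {IH} => //= p; case: eqP => // -[].
Qed.

End FreeByCyclic.

(** * Automorphisms fixing all ends *)

Section Exponents.
Variable g : nat.
Notation P := (pi1 g).
Notation gen := ('I_g * bool)%type.
Implicit Types (x y : P) (s : gen).

Definition wexp s (w : word g) : int :=
  foldr (fun l k => ((if l.1 == s then (if l.2 then -1 else 1) else 0) + k)%R) 0%R w.

Lemma wexp_cat s u v : wexp s (u ++ v) = (wexp s u + wexp s v)%R.
Proof. by elim: u => /= [|l u ->]; lia. Qed.

Lemma wexp_relator s : wexp s (relator g) = 0%R.
Proof.
rewrite /relator; elim: (enum _) => //= i r IH.
by rewrite IH; do 2!case: (_ == s); lia.
Qed.

Lemma wexp_surf_rel s u v : surf_rel u v -> wexp s u = wexp s v.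
Proof.
elim=> {u v} [u v|//|u v _ -> //|u v w _ -> _ -> //].
case=> [a b l|a b]; rewrite !wexp_cat ?wexp_relator /=; last by lia.
by case: l => t []; rewrite /linv /=; case: (t == s) => /=; lia.
Qed.

Definition expo s x : int := wexp s (rep x).

Lemma expo_cls s w : expo s (cls w) = wexp s w.
Proof. exact: wexp_surf_rel (rep_cls w). Qed.

Lemma expoM s x y : expo s (x * y) = (expo s x + expo s y)%R.
Proof. by rewrite -[x]repK -[y]repK -cls_cat !expo_cls wexp_cat. Qed.

Lemma expo1 s : expo s 1 = 0%R.
Proof. by rewrite -cls_nil expo_cls. Qed.

Lemma expoV s x : expo s x^-1 = (- expo s x)%R.
Proof. by have := expoM s x x^-1; rewrite mulgV expo1; lia. Qed.

Lemma expoX s x m : expo s (x ^+ m) = (expo s x *+ m)%R.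
Proof.
elim: m => [|m IH]; first by rewrite expo1.
by rewrite expgS expoM IH GRing.mulrS.
Qed.

Lemma expo_gen s t : expo s (gen_elt t) = (t == s)%:R%R.
Proof. by rewrite expo_cls /=; case: (t == s). Qed.

Lemma expo_inford s x : expo s x <> 0%R -> inford x.
Proof.
move=> h [//|m] _ e; apply: h; have := expoX s x m.+1; rewrite e expo1.
by move=> /esym/eqP; rewrite Num.Theory.mulrn_eq0 => /eqP.
Qed.

Lemma gen_not_sim s t : s != t -> ~ sim (gen_elt s) (gen_elt t).
Proof.
move=> st [p [q [hp hq e]]]; have := congr1 (expo s) e.
rewrite !expoX !expo_gen eqxx eq_sym (negbTE st) GRing.mul0rn.
by move=> /eqP; rewrite Num.Theory.mulrn_eq0 -leqn0 leqNgt hp.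
Qed.

End Exponents.

Section PowersOfAutomorphisms.
Variable g : nat.
Notation P := (pi1 g).
Implicit Types (x y : P).

Lemma pigeonhole (T : Type) (l : seq T) (f : nat -> T) :
  (forall k, List.In (f k) l) -> exists i j, i < j /\ f i = f j.
Proof.
move=> hf.
have hidx k : exists i : 'I_(size l), List.nth_error l i = Some (f k).
  have [i e] := List.In_nth_error _ _ (hf k).
  have hi : i < size l.
    by apply/ltP; apply/List.nth_error_Some; rewrite e.
  by exists (Ordinal hi).
pose h (k : 'I_(size l).+1) := projT1 (cid (hidx k)).
have hP k : List.nth_error l (h k) = Some (f k) by rewrite /h; case: (cid _).
have /injectivePn[i [j ij e]] : ~~ injectiveb h.
  apply/negP => /injectiveP /leq_card; rewrite !card_ord ltnn //.
have ef : f i = f j.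
  by have := hP i; rewrite e hP => -[].
case: (ltngtP i j) => lt; first by exists i, j.
  by exists j, i.
by case/eqP: ij; apply: val_inj.
Qed.

Lemma finite_order (S : (P -> P) -> Prop) phi : aut_subgroup S -> finite_set S ->
  S phi -> exists2 m, 0 < m & forall x, iter m phi x = x.
Proof.
move=> [hS1 [hS2 [hS3 _]]] [l hl] hp.
have hpow k : S (fun x => iter k phi x).
  elim: k => [|k IH]; first exact: hS2.
  exact: hS3 hp IH.
have [i [j [lt e]]] := pigeonhole (fun k => hl _ (hpow k)).
exists (j - i); rewrite ?subn_gt0 // => x.
have [[phi' K _] _] := hS1 _ (hpow i).
apply: (can_inj K); rewrite -iterD subnKC ?(ltnW lt) //.
by rewrite -[RHS]/((fun x => iter i phi x) x) e.
Qed.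

(** From [phi x ^+ p = x ^+ q], iteration [m] times gives x^(p^m) = x^(q^m), so [p = q]. *)
Lemma sim_fixed phi x m : {morph phi : x y / x * y} -> 0 < m ->
  iter m phi x = x -> inford x -> sim (phi x) x ->
  exists2 p, 0 < p & phi x ^+ p = x ^+ p.
Proof.
move=> phiM m_gt0 em hx [p [q [hp hq e]]].
have h k : (iter k phi x) ^+ (p ^ k) = x ^+ (q ^ k).
  elim: k => [//|k IH]; rewrite iterS expnSr expgnA -(autX phiM) IH (autX phiM).
  by rewrite expgnAC e -expgnA expnS.
exists p => //; rewrite e.
have := h m; rewrite em => /(inford_inj hx)/eqP.
by rewrite eqn_exp2r // => /eqP ->.
Qed.

End PowersOfAutomorphisms.

(** * Faithfulness of the action on ends *)

Section Faithful.
Variable n : nat.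
Notation g := n.+2.
Notation P := (pi1 g).
Notation gen := ('I_g * bool)%type.
Implicit Types (x y t : P).

Definition i1 : 'I_g := lift ord0 ord0.
Definition sb0 : gen := (ord0, true).
Definition sa1 : gen := (i1, false).

Lemma nf2_expo x : (nf x).2 = expo (ord0, false) x.
Proof.
have h (u : word g) w k : (wact (w, k) u).2 = (k + wexp (ord0, false) u)%R.
  elim: u w k => [|l u IH] w k /=; first by lia.
  case: l => -[i e] ng; rewrite [lact _ _]surjective_pairing IH /lact /= xpair_eqE.
  by case: (i == ord0); case: e; case: ng => /=; lia.
by rewrite /nf /gact h GRing.add0r.
Qed.

(** The normal form of [t] would be written both in b_0 alone and in a_1 alone, two distinct free
    letters. *)
Lemma commute_trivial t p q : expo (ord0, false) t = 0%R -> 0 < p -> 0 < q ->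
  commute t (gen_elt sb0 ^+ p) -> commute t (gen_elt sa1 ^+ q) -> t = 1.
Proof.
move=> t0 hp hq c1 c2; rewrite -nf2_expo in t0.
have ev1 : evl (bX n.+1, false) = gen_elt sb0.
  by rewrite /evl /= /zp expg0; gsimp.
have ev2 : evl ((sa1, 0%R), false) = gen_elt sa1.
  by rewrite /evl /= /zp expg0; gsimp.
have a1 : all (fun l : _ * bool => l.1 == bX n.+1) (nf t).1.
  apply: (commute_letter (p := p)) => //; last by rewrite ev1.
have a2 : all (fun l : _ * bool => l.1 == (sa1, 0%R)) (nf t).1.
  by apply: (commute_letter (p := q)) => //; rewrite ev2.
rewrite -[t]ev_nf /ev t0; case: (nf t).1 a1 a2 => [_ _|l w /= /andP[/eqP -> _]].
  by rewrite /= /zp expg0 mulg1.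
by move=> /andP[].
Qed.

Definition base_points : seq P :=
  flatten [seq [:: gen_elt s; gen_elt s * gen_elt sb0 * (gen_elt s)^-1;
                   gen_elt s * gen_elt sa1 * (gen_elt s)^-1]
          | s <- enum {: gen}].

Lemma base_points_inford x : x \in base_points -> inford x.
Proof.
case/flatten_mapP=> s _; rewrite !inE => /or3P[] /eqP ->.
- by apply: (@expo_inford _ s); rewrite expo_gen eqxx.
- apply: (@expo_inford _ sb0); rewrite !expoM expoV !expo_gen eqxx.
  by case: (s == sb0).
apply: (@expo_inford _ sa1); rewrite !expoM expoV !expo_gen eqxx.
by case: (s == sa1).
Qed.

Lemma fixed_ends_id (S : (P -> P) -> Prop) phi :
  aut_subgroup S -> finite_set S -> S phi ->
  (forall x, x \in base_points -> sim (phi x) x) -> phi = id.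
Proof.
move=> hS fS hp hsim.
have phiM : {morph phi : x y / x * y} by exact: (proj2 (proj1 hS _ hp)).
have [m m_gt0 hm] := finite_order hS fS hp.
have hfix x : x \in base_points -> exists2 p, 0 < p & phi x ^+ p = x ^+ p.
  move=> hx; apply: (sim_fixed phiM m_gt0 (hm x)) (hsim x hx).
  exact: base_points_inford.
have inb s : [/\ gen_elt s \in base_points,
    gen_elt s * gen_elt sb0 * (gen_elt s)^-1 \in base_points &
    gen_elt s * gen_elt sa1 * (gen_elt s)^-1 \in base_points].
  by split; apply/flatten_mapP; exists s; rewrite ?mem_enum // !inE eqxx ?orbT.
(* At the common exponent [p * q], [phi] fixes the powers of [c] and of its conjugate by [s]. So
   [phi s] and [s] conjugate this power of [c] to the same element. *)
have comm s c : gen_elt c \in base_points ->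
    gen_elt s * gen_elt c * (gen_elt s)^-1 \in base_points ->
    exists2 N, 0 < N & commute ((gen_elt s)^-1 * phi (gen_elt s)) (gen_elt c ^+ N).
  move=> h1 h2; have [p hp0 ep] := hfix _ h1; have [q hq0 eq] := hfix _ h2.
  have conjX y z k : (y * z * y^-1) ^+ k = y * z ^+ k * y^-1.
    elim: k => [|k IH]; first by rewrite !expg0 mulg1 mulgV.
    by rewrite !expgS IH; gsimp.
  have e1 : phi (gen_elt c) ^+ (p * q) = gen_elt c ^+ (p * q) by rewrite !expgnA ep.
  have e2 : (phi (gen_elt s) * phi (gen_elt c) * (phi (gen_elt s))^-1) ^+ (p * q)
          = (gen_elt s * gen_elt c * (gen_elt s)^-1) ^+ (p * q).
    by rewrite mulnC !expgnA -(autV phiM) -!phiM eq.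
  exists (p * q)%N; first by rewrite muln_gt0 hp0.
  move: e2; rewrite !conjX e1 => e2.
  rewrite /commute; set X := gen_elt c ^+ _ in e2 *.
  have e3 : phi (gen_elt s) * X = gen_elt s * X * (gen_elt s)^-1 * phi (gen_elt s).
    by rewrite -e2 mulgVK.
  by rewrite -mulgA e3 !mulgA mulVg mul1g.
have hgen s : phi (gen_elt s) = gen_elt s.
  have [h1 h2 h3] := inb s.
  have [b1 _ _] := inb sb0; have [a1 _ _] := inb sa1.
  have [p hp0 c1] := comm s sb0 b1 h2.
  have [q hq0 c2] := comm s sa1 a1 h3.
  have t1 : (gen_elt s)^-1 * phi (gen_elt s) = 1.
    apply: (commute_trivial _ hp0 hq0 c1 c2).
    (* A positive power of [s] is fixed, so [s] and [phi s] have equal exponents in a_0. *)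
    have [r hr er] := hfix _ h1.
    have := congr1 (expo (ord0, false)) er; rewrite !expoX => /eqP.
    rewrite (Num.Theory.eqr_pMn2r hr) => /eqP e.
    by rewrite expoM expoV e; lia.
  by rewrite -[LHS](mulVKg (gen_elt s)) t1 mulg1.
apply: funext => x; rewrite -[x]repK; elim: (rep x) => [|l w IH].
  by rewrite cls_nil (aut1 phiM).
rewrite (cls_cons l w) phiM IH; congr (_ * _).
by rewrite cls_letter; case: ifP => _; rewrite ?(autV phiM) hgen.
Qed.

End Faithful.

(** * Finite subgroups of automorphisms *)

Lemma notin2 (T : eqType) (z u v : T) :
  (z \notin [:: u; v]) = (z != u) && (z != v).
Proof. by rewrite !inE negb_or. Qed.

Section FiniteSubgroup.
Variable n : nat.
Notation g := n.+2.
Notation P := (pi1 g).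
Variable S : (P -> P) -> Prop.
Hypotheses (subS : aut_subgroup S) (finS : finite_set S).
Implicit Types (x y : P) (phi psi : P -> P).

Lemma S_morph phi : S phi -> {morph phi : x y / x * y}.
Proof. by move=> /(proj1 subS)[]. Qed.

Lemma S_inverse phi : S phi ->
  exists psi, [/\ S psi, cancel phi psi & cancel psi phi].
Proof.
have [_ [_ [_ inv]]] := subS; move=> h.
have [psi hpsi e] := inv _ h; have [chi hchi e'] := inv _ hpsi.
have c1 x : psi (phi x) = x by rewrite -[LHS]/((psi \o phi) x) e.
have c2 x : chi (psi x) = x by rewrite -[LHS]/((chi \o psi) x) e'.
exists psi; split=> // x.
by rewrite -[phi _]c2 c1 c2.
Qed.

Lemma In_mem_map (T : Type) (U : eqType) (f : T -> U) (a : T) l :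
  List.In a l -> f a \in map f l.
Proof.
elim: l => //= b l IH [->|/IH h]; first exact: mem_head.
by rewrite inE h orbT.
Qed.

Lemma orbit_exists : exists W : seq P,
  [/\ {subset @base_points n <= W}, forall x, x \in W -> inford x &
      forall phi x, S phi -> x \in W -> phi x \in W].
Proof.
have [l hl] := finS; have [_ [sid [scomp _]]] := subS.
(* The list given by finiteness may contain maps outside [S]. *)
pose l' := [seq phi <- l | `[< S phi >]].
have hl' phi : S phi -> List.In phi l'.
  move=> h; have := hl _ h; rewrite /l'; elim: (l) => //= psi r IH [e|/IH hr].
    by rewrite e asboolT //=; left.
  by case: asbool => //=; right.
exists (flatten [seq [seq phi x | phi <- l'] | x <- @base_points n]); split.
- move=> x hx; apply/flatten_mapP; exists x => //.
  exact: (@In_mem_map _ _ (fun phi => phi x) id _ (hl' _ sid)).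
- move=> y /flatten_mapP[x hx] hy.
  have [phi hphi ->] : exists2 phi, S phi & y = phi x.
    move: hy; rewrite /l'; elim: (l) => //= psi r IH.
    case: asboolP => //= hpsi; rewrite inE => /orP[/eqP ->|//].
    by exists psi.
  have [psi [_ c1 c2]] := S_inverse hphi.
  exact: (aut_inford (S_morph hphi) c1 (base_points_inford hx)).
move=> psi y hpsi /flatten_mapP[x hx] hy; apply/flatten_mapP; exists x => //.
have [phi hphi ->] : exists2 phi, S phi & y = phi x.
  move: hy; rewrite /l'; elim: (l) => //= chi r IH.
  case: asboolP => //= hchi; rewrite inE => /orP[/eqP ->|//].
  by exists chi.
apply: (@In_mem_map _ _ (fun phi => phi x) (psi \o phi)).
exact: hl' (scomp _ _ hpsi hphi).
Qed.

Let W : seq P := projT1 (cid orbit_exists).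
Let WP := projT2 (cid orbit_exists).

Lemma W_base x : x \in @base_points n -> x \in W.
Proof. by have [h _ _] := WP; apply: h. Qed.
Lemma W_inford x : x \in W -> inford x.
Proof. by have [_ h _] := WP; apply: h. Qed.
Lemma W_closed phi x : S phi -> x \in W -> phi x \in W.
Proof. by have [_ _ h] := WP; apply: h. Qed.

(** Picking the first element of [W] with the same end gives one representative per end. *)
Definition endrep x : P := nth 1 W (find (fun y => `[< sim y x >]) W).

Lemma endrepP x : x \in W -> endrep x \in W /\ sim (endrep x) x.
Proof.
move=> hx; have hh : has (fun y => `[< sim y x >]) W.
  by apply/hasP; exists x => //; apply/asboolP/sim_refl.
split; first by rewrite mem_nth // -has_find.
by have := nth_find 1 hh => /asboolP.
Qed.

Lemma endrep_sim x y : sim x y -> endrep x = endrep y.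
Proof.
move=> h; rewrite /endrep; congr nth; apply: eq_find => z.
by apply: asbool_equiv_eq; split=> hz; apply: sim_trans hz _ => //; apply: sim_sym.
Qed.

Definition ends : finType := seq_sub (undup (map endrep W)).

Lemma end_in (u : ends) : val u \in W /\ endrep (val u) = val u.
Proof.
have := valP u; rewrite /= mem_undup => /mapP[x hx ->].
by have [h1 h2] := endrepP hx; split=> //; apply: endrep_sim.
Qed.

Lemma end_inford (u : ends) : inford (val u).
Proof. by apply: W_inford; case: (end_in u). Qed.

Lemma end_sim (u v : ends) : sim (val u) (val v) -> u = v.
Proof.
move=> h; apply: val_inj; have [_ <-] := end_in u; have [_ <-] := end_in v.
exact: endrep_sim.
Qed.

Lemma end_of x : x \in W -> exists u : ends, sim (val u) x.
Proof.
move=> hx; have h : endrep x \in undup (map endrep W).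
  by rewrite mem_undup map_f.
by exists (SeqSub h); case: (endrepP hx).
Qed.

Lemma end_act_ex phi (u : ends) :
  exists v : ends, S phi -> sim (val v) (phi (val u)).
Proof.
have [h|h] := pselect (S phi); last by exists u.
by have [v hv] := end_of (W_closed h (proj1 (end_in u))); exists v.
Qed.

(** For maps outside [S] the chosen end is arbitrary. *)
Definition end_act phi (u : ends) : ends := projT1 (cid (end_act_ex phi u)).

Lemma end_actP phi u : S phi -> sim (val (end_act phi u)) (phi (val u)).
Proof. by move=> h; exact: (projT2 (cid (end_act_ex phi u)) h). Qed.

Lemma S_sim phi x y : S phi -> sim x y -> sim (phi x) (phi y).
Proof. by move=> h; apply: (aut_sim (S_morph h)). Qed.

Lemma end_act_id u : end_act id u = u.
Proof. by apply: end_sim; apply: end_actP; case: subS => _ []. Qed.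

Lemma end_act_comp phi psi u : S phi -> S psi ->
  end_act (phi \o psi) u = end_act phi (end_act psi u).
Proof.
move=> h1 h2; have h12 : S (phi \o psi) by have [_ [_ [h _]]] := subS; apply: h.
apply: end_sim; apply: sim_trans (end_actP u h12) _.
apply: sim_sym; apply: sim_trans (end_actP _ h1) _.
exact/(S_sim h1)/end_actP.
Qed.

Lemma end_act_inv phi : S phi -> exists psi,
  [/\ S psi, cancel (end_act phi) (end_act psi) &
      cancel (end_act psi) (end_act phi)].
Proof.
move=> h; have [psi [hpsi c1 c2]] := S_inverse h; exists psi; split=> // u.
  by rewrite -end_act_comp // (_ : psi \o phi = id) ?end_act_id //; apply: funext.
by rewrite -end_act_comp // (_ : phi \o psi = id) ?end_act_id //; apply: funext.
Qed.

Definition esep (u v z w : ends) : bool :=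
  `[< sep (val u) (val v) (val z) (val w) >].

Lemma not_sim_ends (u v : ends) : u != v -> ~ sim (val u) (val v).
Proof. by move=> /eqP h /end_sim. Qed.

Lemma esepC u v z w : esep u v z w = esep v u z w.
Proof. by apply: asbool_equiv_eq; split; apply: sepC. Qed.

Lemma esepCr u v z w : esep u v z w = esep u v w z.
Proof. by apply: asbool_equiv_eq; split; apply: sepCr. Qed.

Lemma esep_xor u v z w t : u != v ->
  z \notin [:: u; v] -> w \notin [:: u; v] -> t \notin [:: u; v] ->
  esep u v z t = esep u v z w (+) esep u v w t.
Proof.
move=> uv; rewrite !notin2 => /andP[zu zv] /andP[wu wv] /andP[tu tv].
by apply: sep_xor; try exact: end_inford; apply: not_sim_ends.
Qed.

Lemma esep_total a b c d : uniq [:: a; b; c; d] ->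
  [|| esep a b c d, esep a c b d | esep a d b c].
Proof.
move=> /uniq4P[[ab ac ad] [bc bd cd]].
have [] := @sep_total g (val a) (val b) (val c) (val d);
  try exact: end_inford; try exact: not_sim_ends.
- by move=> h; apply/or3P; constructor 1; apply/asboolP.
- by move=> h; apply/or3P; constructor 2; apply/asboolP.
by move=> h; apply/or3P; constructor 3; apply/asboolP.
Qed.

Lemma esep_excl a b c d : uniq [:: a; b; c; d] ->
  esep a b c d -> esep a c b d -> False.
Proof.
move=> /uniq4P[[ab ac ad] [bc bd cd]] /asboolP h1 /asboolP h2.
by apply: (sep_excl _ _ _ _ _ h1 h2); try exact: end_inford; apply: not_sim_ends.
Qed.

Lemma esep_act1 phi u v z w : S phi -> esep u v z w ->
  esep (end_act phi u) (end_act phi v) (end_act phi z) (end_act phi w).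
Proof.
move=> h /asboolP s; apply/asboolP.
have [psi [_ c1 c2]] := S_inverse h.
have := sep_aut (S_morph h) c1 c2 s.
by apply: sep_sim; apply/sim_sym/end_actP.
Qed.

Lemma esep_act phi u v z w : S phi ->
  esep (end_act phi u) (end_act phi v) (end_act phi z) (end_act phi w)
  = esep u v z w.
Proof.
move=> h; apply/idP/idP; last exact: esep_act1.
have [psi [hpsi c1 c2]] := end_act_inv h.
by move/(esep_act1 hpsi); rewrite !c1.
Qed.

Lemma ends_three : exists a b c : ends, [/\ a != b, a != c & b != c].
Proof.
have hW s : gen_elt s \in W.
  apply: W_base; apply/flatten_mapP; exists s; first by rewrite mem_enum.
  by rewrite inE eqxx.
have [a ha] := end_of (hW (ord0, false)).
have [b hb] := end_of (hW (ord0, true)).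
have [c hc] := end_of (hW (i1 n, false)).
have key (s t : 'I_g * bool) (u v : ends) : s != t ->
    sim (val u) (gen_elt s) -> sim (val v) (gen_elt t) -> u != v.
  move=> st hu hv; apply/eqP => e; apply: (gen_not_sim st).
  by apply: sim_trans (sim_sym hu) _; rewrite e.
exists a, b, c; split.
- exact: key ha hb.
- exact: key ha hc.
exact: key hb hc.
Qed.

Lemma esep_cyclic : cyclic_separation esep.
Proof.
split; [exact: esepC | exact: esepCr | exact: esep_xor | exact: esep_total
       | exact: esep_excl | exact: ends_three].
Qed.

Local Notation eadj := (adj esep).
Local Notation enb := (nb esep).

Lemma adj_act1 phi u v : S phi -> eadj u v ->
  eadj (end_act phi u) (end_act phi v).
Proof.
move=> h /andP[uv /forallP huv]; have [psi [hpsi c1 c2]] := end_act_inv h.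
rewrite /adj (inj_eq (can_inj c1)) uv /=.
apply/forallP => z; apply/forallP => w.
have /forallP/(_ (end_act psi w)) := huv (end_act psi z).
rewrite -(esep_act u v _ _ h) !c2 !notin2.
by rewrite -!(inj_eq (can_inj c1) (end_act psi _)) !c2.
Qed.

Lemma nb_act phi u v : S phi -> eadj u v ->
  end_act phi (enb u v) = enb (end_act phi u) (end_act phi v).
Proof.
move=> h a; have [psi [hpsi c1 c2]] := end_act_inv h.
have /andP[a' n'] := nbP esep_cyclic a.
apply: (nb_uniq esep_cyclic).
- exact: adj_act1.
- exact: adj_act1.
by rewrite (inj_eq (can_inj c1)).
Qed.

Local Notation eflag := (flag esep).
Local Notation estep :=
  (step esep_cyclic).
Local Notation eflip := (flip esep_cyclic).

Definition flag_act phi (f : eflag) : eflag :=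
  insubd f (end_act phi (val f).1, end_act phi (val f).2).

Lemma val_flag_act phi f : S phi ->
  val (flag_act phi f) = (end_act phi (val f).1, end_act phi (val f).2).
Proof. by move=> h; rewrite insubdK //; apply: adj_act1 => //; apply: (valP f). Qed.

Lemma finite_subgroup_cyclic_or_dihedral : cyclic_sg S \/ dihedral_sg S.
Proof.
have [a [b [c [ab ac bc]]]] := ends_three.
have [u au _] := adj_other esep_cyclic ab ac bc.
pose f0 : eflag := exist _ (a, u) au.
have sid : S id by case: subS => _ [].
have act_step phi : S phi -> forall f, flag_act phi (estep f) = estep (flag_act phi f).
  move=> h f; apply: val_inj; rewrite (val_flag_act _ h) !val_step.
  rewrite (val_flag_act _ h) (nb_act h) //.
  by rewrite (adj_sym esep_cyclic); apply: (valP f).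
apply: (@cyclic_or_dihedral g S eflag estep eflip flag_act f0 subS).
- exact: flipK.
- exact: step_flip_step.
- exact: flag_trans.
- move=> f; apply: val_inj; rewrite val_flag_act // !end_act_id.
  by rewrite -surjective_pairing.
- move=> phi psi h1 h2 f.
  have h12 : S (phi \o psi) by have [_ [_ [h _]]] := subS; apply: h.
  apply: val_inj; rewrite (val_flag_act _ h12) (val_flag_act _ h1).
  by rewrite (val_flag_act _ h2) (end_act_comp _ h1 h2) (end_act_comp _ h1 h2).
- exact: act_step.
- move=> phi h f; apply: val_inj.
  by rewrite (val_flag_act _ h) !val_flip (val_flag_act _ h).
(* Freeness: a map that fixes [f0] fixes its orbit under [step], which by [step_reach] visits every
   end, in particular those of the base points. *)
move=> phi h e; apply: (fixed_ends_id subS finS h) => x hx.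
have fixit k : flag_act phi (iter k estep f0) = iter k estep f0.
  by elim: k => //= k IH; rewrite act_step // IH.
have [v hv] := end_of (W_base hx).
have [f hf ef] := step_reach esep_cyclic f0 v.
have ev : end_act phi v = v.
  have := congr1 (fun f1 => (val f1).1) (fixit (findex estep f0 f)).
  by rewrite iter_findex // (val_flag_act _ h) ef.
apply: sim_trans (S_sim h (sim_sym hv)) _.
by apply: sim_trans (sim_sym (end_actP v h)) _; rewrite ev.
Qed.

End FiniteSubgroup.

Theorem theorem2 (g : nat) (S : (pi1 g -> pi1 g) -> Prop) :
  1 < g -> aut_subgroup S -> finite_set S -> cyclic_sg S \/ dihedral_sg S.
Proof.
case: g S => [|[|n]] S // _ subS finS.
exact: finite_subgroup_cyclic_or_dihedral.
Qed.
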